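(* Let $i\in\{1,\ldots,N\}$. For $R>0$ let $\lambda^R$ denote the principal eigenvalue of $$-\Delta_{\Omega^R}\varphi-f'(\widehat v_i)\varphi=\lambda\varphi\ \text{ in }\Omega^R,\qquad\varphi=0\ \text{ on }\partial\Omega^R .$$ Then $\lambda^R>0$ for all $R>0$.
   Context: Metric graphs: a metric graph is a connected graph each of whose edges $E$ is identified with an interval $[0,L_E]$ (finite length $L_E>0$) or $[0,\infty)$ (infinite length); directions of edges only serve to fix coordinates. Multiple edges, loops and vertices of degree $1$ are allowed. Each edge $E$ has a constant thickness $\rho_E>0$. At a vertex $V$ with incident edges $E_1,\ldots,E_m$ (a loop is counted twice), $\frac{\partial u}{\partial\nu_k}(V)$ denotes the derivative of $u$ at $V$ along $E_k$ in the direction pointing from $V$ into the interior of $E_k$; the Kirchhoff condition at $V$ is $\sum_{k=1}^m\rho_{E_k}\frac{\partial u}{\partial\nu_k}(V)=0$. The graph $\Omega$: $\Omega=D\cup\Omega_1\cup\cdots\cup\Omega_N$ with $N\ge2$, where $D$ (the center graph) is a bounded finite metric graph (finitely many edges of finite length; possibly a single vertex) and each outer path $\Omega_i$ is an edge of infinite length with $D\cap\Omega_i=\{\mathrm P_i\}$, $\mathrm P_i$ being a vertex of $D$ (the $\mathrm P_i$ are not necessarily distinct). The coordinate on $\Omega_i$ is $x_i\in[0,\infty)$, with $x_i=0$ at $\mathrm P_i$. Nonlinearity: $f\in C^1$ and for some $0<a<1$: $f(0)=f(a)=f(1)=0$, $f<0$ on $(0,a)$, $f>0$ on $(a,1)$,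 $f'(0)<0$, $f'(a)>0$, $f'(1)<0$, $\int_0^1f(s)\,ds>0$. Solution of $\partial_tu=\Delta_\Omega u+f(u)$ on a time interval: a function $u(t,x)$ continuous in $(t,x)$ that satisfies $\partial_tu=\partial_x^2u+f(u)$ on each edge except at endpoints, with $\partial_xu$ continuous on each edge up to the endpoints, and the Kirchhoff condition at every vertex. Traveling wave: $(\phi,c)$, $c>0$, is the unique pair with $\phi''+c\phi'+f(\phi)=0$ and $0<\phi<1$ on $\mathbb R$, $\phi(-\infty)=1$, $\phi(+\infty)=0$, $\phi(0)=a$. Front-like solution and limit profile: for each $i$ there is a unique entire solution $\widehat u_i$ (defined for all $t\in\mathbb R$) with $0<\widehat u_i<1$ and $\lim_{t\to-\infty}\big(\sup_{x_i\in\Omega_i}|\widehat u_i|_{\Omega_i}(t,x_i)-\phi(-x_i-ct)|+\sup_{\Omega\setminus\Omega_i}|\widehat u_i(t,\cdot)|\big)=0$; it is strictly increasing in $t$. The limit profile is $\widehat v_i(x)=\lim_{t\to\infty}\widehat u_i(t,x)$. Truncated graph: for $R>0$, $\Omega_j[R]=\{x\in\Omega_j: 0\le x_j\le R\}$, $\mathrm P_j^R$ is the point of $\Omega_j$ with $x_j=R$, $\Omega^R=D\cup\Omega_1[R]\cup\cdots\cup\Omega_N[R]$ and $\partial\Omega^R=\{\mathrm P_1^R,\ldots,\mathrm P_N^R\}$. The eigenvalue problem is understood as: $\varphi$ is continuous on $\Omega^R$, satisfies $-\partial_x^2\varphi-f'(\widehat v_i)\varphi=\lambda\varphi$ on each edge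 and the Kirchhoff condition at every vertex of $\Omega^R$ not in $\partial\Omega^R$, and vanishes on $\partial\Omega^R$. The principal eigenvalue is the smallest eigenvalue, i.e. the one having an eigenfunction positive on $\Omega^R\setminus\partial\Omega^R$. *)

(* Defs.v *)
From HB Require Import structures.
From mathcomp Require Import all_boot all_order all_algebra.
From mathcomp Require Import all_classical all_reals all_analysis.

Set Implicit Arguments.
Unset Strict Implicit.
Unset Printing Implicit Defensive.

Import Order.TTheory GRing.Theory Num.Theory.
Import numFieldNormedType.Exports.

Local Open Scope classical_set_scope.
Local Open Scope ring_scope.

(* An edge [e] is the interval [0, L] if [term e = Some (L, w)]: coordinate 0
   sits at the vertex [orig e] and coordinate L at the vertex [w].  It is the
   half-line [0, +oo[ starting at [orig e] if [term e = None].  Loops and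
   multiple edges are allowed. *)
Record metric_graph (R : realType) := MetricGraph {
  vertex : finType;
  edge : finType;
  orig : edge -> vertex;
  term : edge -> option (R * vertex);
  thickness : edge -> R }.

Arguments orig {R} _ _.
Arguments term {R} _ _.
Arguments thickness {R} _ _.

Definition joined (R : realType) (G : metric_graph R) : rel (vertex G) :=
  fun v w => [exists e : edge G,
    ((orig G e == v) && (omap snd (term G e) == Some w))
    || ((orig G e == w) && (omap snd (term G e) == Some v))].

Definition is_metric_graph (R : realType) (G : metric_graph R) : Prop :=
  [/\ forall e L w, term G e = Some (L, w) -> 0 < L,
      forall e, 0 < thickness G e
    & forall v w, connect (@joined R G) v w].

Definition bounded_graph (R : realType) (G : metric_graph R) : Prop :=
  forall e, term G e <> None.

Definition edge_dom (R : realType) (G : metric_graph R) (e : edge G) : set R :=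
  [set x | 0 <= x /\ if term G e is Some (L, _) then x <= L else True].

Definition edge_interior (R : realType) (G : metric_graph R) (e : edge G) :
    set R :=
  [set x | 0 < x /\ if term G e is Some (L, _) then x < L else True].

Definition at_vertex (R : realType) (G : metric_graph R)
    (e : edge G) (x : R) (v : vertex G) : Prop :=
  (x = 0 /\ orig G e = v) \/ term G e = Some (x, v).

(* A real function on the graph is given by its restrictions to the edges, in
   the coordinates of the edges; values outside [edge_dom] are irrelevant. *)
Definition graph_fun (R : realType) (G : metric_graph R) : Type :=
  edge G -> R -> R.

(* The restrictions to the edges define a function on the graph: the values at
   all the edge ends located at a given vertex agree. *)
Definition single_valued (R : realType) (G : metric_graph R)
    (g : graph_fun G) : Prop :=
  exists gv : vertex G -> R,
    forall e x v, at_vertex e x v -> g e x = gv v.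

(* [d] is the derivative of [g] at [x] relative to [A]: one-sided at an
   endpoint of an interval, the usual derivative in the interior. *)
Definition is_derive_within (R : realType) (A : set R) (g : R -> R) (x d : R) :
    Prop :=
  (g y - g x) / (y - x) @[y --> within A x^'] --> d.

(* [dg] is the derivative of a function with respect to the coordinates of the
   edges.  The derivative pointing into an edge is [dg] at coordinate 0 and
   [- dg] at coordinate L; a loop contributes both terms. *)
Definition kirchhoff (R : realType) (G : metric_graph R)
    (dg : graph_fun G) (v : vertex G) : Prop :=
  \sum_(e : edge G) thickness G e *
    ((if orig G e == v then dg e 0 else 0)
     + (if term G e is Some (L, w) then if w == v then - dg e L else 0
        else 0)) = 0.

Definition entire_solution (R : realType) (G : metric_graph R) (f : R -> R)
    (u : R -> graph_fun G) : Prop :=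
  (forall e, {within [set p : R * R | edge_dom e p.2],
                continuous (fun p : R * R => u p.1 e p.2)}) /\
  (forall t, single_valued (u t)) /\
  exists ux : R -> graph_fun G,
    [/\ forall t e x, edge_dom e x ->
          is_derive_within (edge_dom e) (u t e) x (ux t e x),
        forall e, {within [set p : R * R | edge_dom e p.2],
                     continuous (fun p : R * R => ux p.1 e p.2)},
        forall (t : R) (e : edge G) (x : R), edge_interior e x ->
          exists ut uxx : R,
            [/\ is_derive t 1 (fun s => u s e x) ut,
                is_derive x 1 (ux t e) uxx
              & ut = uxx + f (u t e x)]
      & forall t v, kirchhoff (ux t) v].

Definition bistable (R : realType) (f : R -> R) (a : R) : Prop :=
  [/\ (forall s, derivable f s 1) /\ continuous f^`()%classic,
      0 < a < 1,
      [/\ f 0 = 0, f a = 0 & f 1 = 0],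
      (forall s, 0 < s < a -> f s < 0) /\ (forall s, a < s < 1 -> 0 < f s)
    & [/\ f^`()%classic 0 < 0, 0 < f^`()%classic a, f^`()%classic 1 < 0
        & 0 < \int[lebesgue_measure]_(s in `[0, 1]) f s]].

Definition traveling_wave (R : realType) (f : R -> R) (a : R)
    (phi : R -> R) (c : R) : Prop :=
  [/\ 0 < c,
      forall z, [/\ derivable phi z 1, derivable phi^`()%classic z 1
                  & phi^`(2)%classic z + c * phi^`()%classic z + f (phi z) = 0],
      forall z, 0 < phi z < 1,
      (phi z @[z --> -oo] --> (1 : R)) /\ (phi z @[z --> +oo] --> (0 : R))
    & phi 0 = a].

(* The center graph [D] with the half-line number [i], of thickness [rho i],
   attached at the vertex [P i] for each [i]. *)
Definition with_outer_paths (R : realType) (D : metric_graph R) (N : nat)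
    (P : 'I_N -> vertex D) (rho : 'I_N -> R) : metric_graph R :=
  {| vertex := vertex D;
     edge := (edge D + 'I_N)%type;
     orig := fun e => match e with inl e => orig D e | inr i => P i end;
     term := fun e => match e with inl e => term D e | inr _ => None end;
     thickness := fun e =>
       match e with inl e => thickness D e | inr i => rho i end |}.

Definition outer_path (R : realType) (D : metric_graph R) (N : nat)
    (P : 'I_N -> vertex D) (rho : 'I_N -> R) (i : 'I_N) :
    edge (with_outer_paths P rho) := inr i.

(* The vertex [inr j] is the new endpoint, at coordinate [r], of the path
   number [j]. *)
Definition truncated (R : realType) (D : metric_graph R) (N : nat)
    (P : 'I_N -> vertex D) (rho : 'I_N -> R) (r : R) : metric_graph R :=
  {| vertex := (vertex D + 'I_N)%type;
     edge := (edge D + 'I_N)%type;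
     orig := fun e => match e with
       | inl e => inl (orig D e)
       | inr i => inl (P i) end;
     term := fun e => match e with
       | inl e => omap (fun p => (p.1, inl p.2)) (term D e)
       | inr j => Some (r, inr j) end;
     thickness := fun e =>
       match e with inl e => thickness D e | inr i => rho i end |}.

(* The points of the graph that do not lie on the outer path number [i], whose
   endpoint [P i] is shared with other edges. *)
Definition off_path (R : realType) (D : metric_graph R) (N : nat)
    (P : 'I_N -> vertex D) (rho : 'I_N -> R) (i : 'I_N) :
    set (edge (with_outer_paths P rho) * R) :=
  [set p : edge (with_outer_paths P rho) * R |
    [/\ p.1 != outer_path P rho i, edge_dom p.1 p.2
      & ~ @at_vertex R (with_outer_paths P rho) p.1 p.2 (P i)]].

Arguments off_path {R D N} P rho i _.

Definition front_like_solution (R : realType) (D : metric_graph R) (N : nat)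
    (P : 'I_N -> vertex D) (rho : 'I_N -> R) (f phi : R -> R) (c : R)
    (i : 'I_N) (u : R -> graph_fun (with_outer_paths P rho)) : Prop :=
  [/\ entire_solution f u,
      forall t (e : edge (with_outer_paths P rho)) (x : R),
        edge_dom e x -> 0 < u t e x < 1
    & sup [set `|u t (outer_path P rho i) x - phi (- x - c * t)|
             | x in edge_dom (outer_path P rho i)]
      + sup [set `|u t p.1 p.2| | p in off_path P rho i]
      @[t --> -oo] --> (0 : R)].

Definition increasing_in_time (R : realType) (G : metric_graph R)
    (u : R -> graph_fun G) : Prop :=
  forall e x, edge_dom e x -> forall s t, s < t -> u s e x < u t e x.

Definition limit_profile (R : realType) (G : metric_graph R)
    (u : R -> graph_fun G) : graph_fun G :=
  fun e x => lim (u t e x @[t --> +oo]).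

(* The eigenvalue problem for [- psi'' - q psi = lambda psi], with the Dirichlet
   condition on the set [bd] of vertices and the Kirchhoff condition at the
   other vertices. *)
Definition eigen_equation (R : realType) (G : metric_graph R)
    (bd : {set vertex G}) (q : graph_fun G) (lambda : R) (psi : graph_fun G) :
    Prop :=
  [/\ forall e, {within edge_dom e, continuous (psi e)},
      single_valued psi,
      exists dpsi : graph_fun G,
        [/\ forall e x, edge_dom e x ->
              is_derive_within (edge_dom e) (psi e) x (dpsi e x),
            forall (e : edge G) (x : R), edge_interior e x ->
              exists2 d2psi : R, is_derive x 1 (dpsi e) d2psi
                & - d2psi - q e x * psi e x = lambda * psi e x
          & forall v, v \notin bd -> kirchhoff dpsi v]
    & forall e x v, v \in bd -> at_vertex e x v -> psi e x = 0].

Definition eigenvalue_of (R : realType) (G : metric_graph R)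
    (bd : {set vertex G}) (q : graph_fun G) (lambda : R) : Prop :=
  exists2 psi : graph_fun G, eigen_equation bd q lambda psi
    & exists e, exists2 x, edge_dom e x & psi e x != 0.

Definition principal_eigenvalue (R : realType) (G : metric_graph R)
    (bd : {set vertex G}) (q : graph_fun G) (lambda : R) : Prop :=
  [/\ eigenvalue_of bd q lambda,
      forall mu, eigenvalue_of bd q mu -> lambda <= mu
    & exists2 psi : graph_fun G, eigen_equation bd q lambda psi
        & forall e x, edge_dom e x ->
            (forall v, v \in bd -> ~ at_vertex e x v) -> 0 < psi e x].

Definition truncation_boundary (R : realType) (D : metric_graph R) (N : nat)
    (P : 'I_N -> vertex D) (rho : 'I_N -> R) (r : R) :
    {set vertex (truncated P rho r)} :=
  [set (inr j : vertex (truncated P rho r)) | j : 'I_N].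

(* Main.v *)
Require Import Defs.
From HB Require Import structures.
From mathcomp Require Import all_boot all_order all_algebra.
From mathcomp Require Import all_classical all_reals all_analysis.
From mathcomp Require Import ring lra.

Set Implicit Arguments.
Unset Strict Implicit.
Unset Printing Implicit Defensive.

Import Order.TTheory GRing.Theory Num.Theory.
Import numFieldNormedType.Exports.

Local Open Scope classical_set_scope.
Local Open Scope ring_scope.

(** The solution [u] increases in time to [v], its limit profile, so each [u t] is
    a subsolution of the stationary equation that lies below [v]:
    [u_xx + f(u) = u_t >= 0].  If [v] could be approached in this way although the
    linearization at [v] had a principal eigenvalue [lambda <= 0] on the truncated
    graph, the positive eigenfunction [psi] would let us insert a strict
    subsolution between [u t] and [v], and the evolution would have to push [u]
    above it at a definite rate, forever.

    For [lambda < 0] the function [psi], extended by zero, is itself a strict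
    subsolution of the linearized equation.  For [lambda = 0] it is not, and the
    slack comes from enlarging the domain: by Hopf's lemma ([hopf_slope]) [psi]
    has a strictly negative slope at the truncation points, so its extension by
    zero has convex kinks there.  A small multiple of a barrier [K] is added to
    [psi].  The barrier satisfies [K'' >= M ^+ 2 * K] for a large [M], hence it is
    a strict subsolution whatever the potential, and its slopes at each vertex
    have a positive weighted sum.  Such a barrier exists on a connected graph as
    soon as it is allowed to grow fast towards the truncation points
    ([exists_outflowing_arch]).  Beyond the truncation points the sum is continued
    by a barrier that decreases to zero; the kinks stay convex if the multiple is
    small.  The result [zeta >= 0] satisfies [zeta'' + f'(v) zeta >= delta * zeta],
    with [delta > 0], and vanishes at the new endpoints.  The argument covers all
    [lambda <= 0] at once.

    [no_strict_subsolution] excludes such a [zeta] by sliding: the largest multiple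
    of [zeta] that fits between [u t0] and [v] is compared with the later motion
    of [u].  It relies on the uniform convergence of [u] to [v] on bounded parts of
    the graph ([limit_profile_uniform]): monotonicity in time makes [u] semiconvex
    in space, uniformly in time, and this gives enough upper semicontinuity of [v]
    for Dini's theorem. *)

(** * One-sided slopes *)

Definition rslope (R : realType) (g : R -> R) (x d : R) : Prop :=
  (g y - g x) / (y - x) @[y --> x^'+] --> d.

Definition lslope (R : realType) (g : R -> R) (x d : R) : Prop :=
  (g y - g x) / (y - x) @[y --> x^'-] --> d.

Lemma is_derive_within_rslope (R : realType) (A : set R) (g : R -> R)
    (x b d : R) : x < b -> (forall y, x < y < b -> A y) ->
  is_derive_within A g x d -> rslope g x d.
Proof.
move=> xb Ab; apply: cvg_trans; apply: cvg_app => U.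
move=> UA; have {}UA : \forall y \near x, y != x -> A y -> U y := UA.
change (\forall y \near x, x < y -> U y).
have nb : \forall y \near x, y < b by exact: lt_nbhsl.
apply: filterS2 UA nb => y UA yb xy.
by apply: UA; [rewrite gt_eqF|apply: Ab; rewrite xy].
Qed.

Lemma is_derive_within_lslope (R : realType) (A : set R) (g : R -> R)
    (x b d : R) : b < x -> (forall y, b < y < x -> A y) ->
  is_derive_within A g x d -> lslope g x d.
Proof.
move=> xb Ab; apply: cvg_trans; apply: cvg_app => U.
move=> UA; have {}UA : \forall y \near x, y != x -> A y -> U y := UA.
change (\forall y \near x, y < x -> U y).
have nb : \forall y \near x, b < y by exact: lt_nbhsr.
apply: filterS2 UA nb => y UA yb xy.
by apply: UA; [rewrite lt_eqF|apply: Ab; rewrite xy yb].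
Qed.

Lemma is_derive_withinT (R : realType) (g : R -> R) (x d : R) :
  is_derive x 1 g d -> is_derive_within setT g x d.
Proof.
move=> /is_derive1_caratheodory [h [gE hC hx]].
have : h y @[y --> within setT x^'] --> d.
  rewrite -hx; apply: cvg_trans hC; apply: cvg_app => U Ux.
  change (\forall y \near x, y != x -> [set: R] y -> U y).
  by apply: filterS Ux => y Uy _ _.
apply: cvg_trans; apply: near_eq_cvg.
change (\forall y \near x, y != x -> [set: R] y ->
  h y = (g y - g x) / (y - x)).
by apply: (@nearW _ (nbhs x)) => y yx _; rewrite gE mulfK // subr_eq0.
Qed.

Lemma is_derive_rslope (R : realType) (g : R -> R) (x d : R) :
  is_derive x 1 g d -> rslope g x d.
Proof.
move=> /is_derive_withinT; apply: (@is_derive_within_rslope _ _ _ _ (x + 1)) => //.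
by rewrite ltrDl.
Qed.

Lemma is_derive_lslope (R : realType) (g : R -> R) (x d : R) :
  is_derive x 1 g d -> lslope g x d.
Proof.
move=> /is_derive_withinT; apply: (@is_derive_within_lslope _ _ _ _ (x - 1)) => //.
by rewrite ltrBlDr ltrDl.
Qed.

Lemma is_derive_of_within (R : realType) (A : set R) (g : R -> R) (x d : R) :
  nbhs x A -> is_derive_within A g x d -> is_derive x 1 g d.
Proof.
move=> nA gA; apply/is_derive1_caratheodory.
exists (fun z => if z == x then d else (g z - g x) / (z - x)).
split; last by rewrite eqxx.
- move=> z; case: eqP => [->|/eqP zx]; first by rewrite !subrr mulr0.
  by rewrite divfK // subr_eq0.
- move=> U /=; rewrite eqxx => Ud.
  have H : \forall y \near x, y != x -> A y -> U ((g y - g x) / (y - x)).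
    exact: gA.
  apply: filterS2 H nA => z Hz Az /=; case: eqP => [_|/eqP zx].
    exact: nbhs_singleton.
  exact: Hz.
Qed.

Lemma rslope_ge0 (R : realType) (g : R -> R) (x b d : R) : x < b ->
  (forall y, x < y < b -> g x <= g y) -> rslope g x d -> 0 <= d.
Proof.
move=> xb gx gd; have <- := cvg_lim (@Rhausdorff R) gd.
apply: limr_ge; first by apply/cvg_ex; exists d.
near=> y; apply: divr_ge0; last by rewrite subr_ge0 ltW.
rewrite subr_ge0; apply: gx; apply/andP; split; near: y.
  exact: nbhs_right_gt.
exact: nbhs_right_lt.
Unshelve. all: by end_near. Qed.

Lemma lslope_le0 (R : realType) (g : R -> R) (x b d : R) : b < x ->
  (forall y, b < y < x -> g x <= g y) -> lslope g x d -> d <= 0.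
Proof.
move=> xb gx gd; have <- := cvg_lim (@Rhausdorff R) gd.
apply: limr_le; first by apply/cvg_ex; exists d.
near=> y; apply: mulr_ge0_le0; last first.
  by rewrite invr_le0 subr_le0 ltW.
rewrite subr_ge0; apply: gx; apply/andP; split; near: y.
  exact: nbhs_left_gt.
exact: nbhs_left_lt.
Unshelve. all: by end_near. Qed.

Lemma rslope_lin (R : realType) (g h : R -> R) (x c dg dh : R) :
  rslope g x dg -> rslope h x dh ->
  rslope (fun y => g y + c * h y) x (dg + c * dh).
Proof.
move=> gd hd; apply: (cvg_trans _ (cvgD gd (cvgM (cvg_cst c) hd))).
apply: near_eq_cvg; near=> y => /=.
by rewrite /cst !fctE /=; ring.
Unshelve. all: by end_near. Qed.

Lemma lslope_lin (R : realType) (g h : R -> R) (x c dg dh : R) :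
  lslope g x dg -> lslope h x dh ->
  lslope (fun y => g y + c * h y) x (dg + c * dh).
Proof.
move=> gd hd; apply: (cvg_trans _ (cvgD gd (cvgM (cvg_cst c) hd))).
apply: near_eq_cvg; near=> y => /=.
by rewrite /cst !fctE /=; ring.
Unshelve. all: by end_near. Qed.

Lemma eq_rslope (R : realType) (g h : R -> R) (x b d : R) : x < b ->
  (forall y, x <= y < b -> g y = h y) -> rslope g x d -> rslope h x d.
Proof.
move=> xb gh; apply: cvg_trans; apply: near_eq_cvg; near=> y.
rewrite !gh ?lexx //; apply/andP; split.
  by near: y; exact: nbhs_right_ge.
by near: y; exact: nbhs_right_lt.
Unshelve. all: by end_near. Qed.

Lemma eq_lslope (R : realType) (g h : R -> R) (x b d : R) : b < x ->
  (forall y, b < y <= x -> g y = h y) -> lslope g x d -> lslope h x d.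
Proof.
move=> xb gh; apply: cvg_trans; apply: near_eq_cvg; near=> y.
rewrite !gh ?lexx ?xb //; apply/andP; split.
  by near: y; exact: nbhs_left_gt.
by near: y; exact: nbhs_left_le.
Unshelve. all: by end_near. Qed.

(** * Minima and second derivatives *)

Lemma near_itvoo (R : realType) (a b x : R) : a < x < b ->
  \forall y \near x, a < y < b.
Proof.
move=> /andP[ax xb]; near=> y; apply/andP; split; near: y.
  exact: lt_nbhsr.
exact: lt_nbhsl.
Unshelve. all: by end_near. Qed.

(** A negative second derivative would make the first derivative, which vanishes
    at the minimum, negative just to the right of it; by the mean value theorem
    the function would decrease there.  The hypothesis on the second
    derivative is pointwise because the equation satisfied by a solution gives its
    existence at each point, not its continuity. *)
Lemma second_derivative_min (R : realType) (g dg : R -> R) (x d : R) :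
  (\forall y \near x, is_derive (y : R) 1 g (dg y)) -> is_derive x 1 dg d ->
  (\forall y \near x, g x <= g y) -> 0 <= d.
Proof.
move=> gd dgd gmin; rewrite leNgt; apply/negP => d0.
have gx := nbhs_singleton gd.
move: gmin gd => /nbhs_ballP[e1 /= e10 gmin] /nbhs_ballP[e2 /= e20 gd].
have dgx0 : dg x = 0.
  apply/eqP; rewrite eq_le; apply/andP; split.
  - apply: (@lslope_le0 _ g x (x - e1)); [by lra| |exact: is_derive_lslope].
    move=> y /andP[ya yb]; apply: gmin.
    by rewrite /ball /= ger0_norm; lra.
  - apply: (@rslope_ge0 _ g x (x + e1)); [by lra| |exact: is_derive_rslope].
    move=> y /andP[ya yb]; apply: gmin.
    by rewrite /ball /= ler0_norm; lra.
(* the derivative vanishes at x and is negative just to the right of x *)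
have : \forall y \near x^'+, (dg y - dg x) / (y - x) < 0.
  exact: (cvgr_lt d (is_derive_rslope dgd)).
move=> /nbhs_ballP[e3 /= e30 dgneg].
pose e := Num.min e1 (Num.min e2 e3) / 2.
have e0 : 0 < e by rewrite divr_gt0 // !lt_min e10 e20 e30.
have [ee1 [ee2 ee3]] : e < e1 /\ e < e2 /\ e < e3.
  rewrite /e; set m := Num.min _ _.
  have m0 : 0 < m by rewrite /m !lt_min e10 e20 e30.
  have : m <= e1 /\ m <= e2 /\ m <= e3.
    by rewrite /m !ge_min !lexx !orbT.
  by move=> [? [? ?]]; split; [|split]; lra.
have gder y : x <= y <= x + e -> is_derive y 1 g (dg y).
  move=> /andP[ya yb]; apply: gd; rewrite /ball /= distrC ger0_norm; lra.
have xe : x < x + e by lra.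
have gcont : {within `[x, x + e], continuous g}.
  apply: derivable_within_continuous => y; rewrite in_itv /= => /gder.
  by case.
have gder' y : y \in `]x, x + e[ -> is_derive y 1 g (dg y).
  by rewrite in_itv /= => /andP[? ?]; apply: gder; rewrite !ltW.
have [z] := MVT xe gder' gcont.
rewrite in_itv /= => /andP[xz zxe] gE.
have : g x <= g (x + e).
  by apply: gmin; rewrite /ball /= ler0_norm; lra.
rewrite -subr_ge0 gE => H.
have := dgneg z; rewrite /ball /= => /(_ _ xz).
rewrite dgx0 subr0 ler0_norm; last by lra.
have -> : - (x - z) < e3 by lra.
move=> /(_ isT); rewrite pmulr_llt0 ?invr_gt0 ?subr_gt0 // => zneg.
have : dg z * (x + e - x) < 0 by rewrite pmulr_llt0 //; lra.
lra.
Qed.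

Lemma is_derive_add_fun (R : realType) (g h : R -> R) (x dg dh : R) :
  is_derive x 1 g dg -> is_derive x 1 h dh ->
  is_derive x 1 (fun y => g y + h y) (dg + dh).
Proof. by move=> gd hd; exact: is_deriveD. Qed.

Lemma is_derive_mul_fun (R : realType) (g h : R -> R) (x dg dh : R) :
  is_derive x 1 g dg -> is_derive x 1 h dh ->
  is_derive x 1 (fun y => g y * h y) (dg * h x + g x * dh).
Proof.
move=> gd hd; have gh := is_deriveM gd hd; apply: (is_derive_eq gh).
by rewrite /GRing.scale /=; ring.
Qed.

Lemma is_derive_lin (R : realType) (g h : R -> R) (x c dg dh : R) :
  is_derive x 1 g dg -> is_derive x 1 h dh ->
  is_derive x 1 (fun y => g y + c * h y) (dg + c * dh).
Proof.
by move=> gd hd; apply: is_derive_add_fun => //.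
Qed.

Lemma is_derive_affine (R : realType) (x A B : R) :
  is_derive x 1 (fun y => A + B * y) B.
Proof.
apply: (is_derive_eq (is_derive_lin B (is_derive_cst A x 1) (is_derive_id x 1))).
by rewrite add0r mulr1.
Qed.

Lemma is_derive_quadratic (R : realType) (x A B C : R) :
  is_derive x 1 (fun y => A + B * y + C * (y * y)) (B + 2 * C * x).
Proof.
apply: (is_derive_eq (is_derive_lin C (is_derive_affine x A B)
  (is_derive_mul_fun (is_derive_id x 1) (is_derive_id x 1)))).
by ring.
Qed.

(** * Monotone limits of semiconvex functions *)

(** Adding [(F + 1) / 2 * x ^+ 2] to [u] makes the second derivative positive, so
    the difference with the chord cannot have an interior maximum. *)
Lemma semiconvex_le_chord (R : realType) (u du : R -> R) (F a b : R) : a < b ->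
  {within `[a, b], continuous u} ->
  (forall x, a < x < b -> is_derive x 1 u (du x)) ->
  (forall x, a < x < b -> exists2 d, is_derive x 1 du d & - F <= d) ->
  forall x, a <= x <= b -> u x <=
    (u b - u a) / (b - a) * (x - a) + u a + (F + 1) / 2 * ((x - a) * (b - x)).
Proof.
move=> ab uc ud udd.
pose s := (u b - u a) / (b - a).
have sE : s * (b - a) = u b - u a by rewrite /s divfK //; lra.
pose B := s + (F + 1) / 2 * (a + b).
pose A := - s * a + u a - (F + 1) / 2 * (a * b).
pose C := - ((F + 1) / 2).
pose q := fun x => A + B * x + C * (x * x).
have qE x : s * (x - a) + u a + (F + 1) / 2 * ((x - a) * (b - x)) = q x.
  by rewrite /q /A /B /C; field.
suff : forall x, a <= x <= b -> 0 <= q x + (-1) * u x.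
  by move=> H x /H; rewrite -/s qE; lra.
have qc : {within `[a, b], continuous (fun x => q x + (-1) * u x)}.
  move=> x; apply: cvgD; last by apply: cvgM; [exact: cvg_cst|exact: uc].
  apply: (@continuous_subspaceT _ _ `[a, b]%classic q) => y.
  apply: differentiable_continuous; apply/derivable1_diffP.
  by have [] := is_derive_quadratic y A B C.
have [c] := EVT_min (ltW ab) qc.
rewrite in_itv /= => /andP[ac cb] cmin x axb.
apply: le_trans (cmin x _); last by rewrite in_itv.
have qa : q a + -1 * u a = 0 by rewrite -qE; ring.
have qb : q b + -1 * u b = 0 by rewrite -qE sE; ring.
case: (eqVneq c a) => [->|ca]; first by rewrite qa.
case: (eqVneq c b) => [->|cb']; first by rewrite qb.
have {}ac : a < c by rewrite lt_neqAle eq_sym ca.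
have {}cb : c < b by rewrite lt_neqAle cb'.
have acb : a < c < b by rewrite ac.
have [d dd Fd] := udd c acb.
have nab := near_itvoo acb.
suff : 0 <= 2 * C + -1 * d by rewrite /C; lra.
apply: (@second_derivative_min _ (fun x => q x + (-1) * u x)
  (fun x => B + 2 * C * x + (-1) * du x) c).
- apply: filterS nab => y yab; apply: is_derive_lin; last exact: ud.
  exact: is_derive_quadratic.
- by apply: is_derive_lin => //; exact: is_derive_affine.
- by apply: filterS nab => y /andP[? ?]; apply: cmin; rewrite in_itv /= !ltW.
Qed.

Lemma within_continuous_near (T : topologicalType) (R : realType) (A : set T)
    (f : T -> R) (x : T) (e : R) :
  {within A, continuous f} -> A x -> 0 < e ->
  \forall y \near x, A y -> `|f y - f x| < e.
Proof.
move=> fc Ax e0; have /cvgrPdist_lt/(_ e e0) := fc x.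
rewrite {1}/nbhs /= -(nbhs_subspace_in Ax) => H.
have {}H : \forall y \near x, A y -> `|f x - f y| < e := H.
by apply: filterS H => y H Ay; rewrite distrC; exact: H.
Qed.

(** The chord from [x0] to the far end of the interval bounds [u] from above on
    either side of [x0].  The constant depends on the distances from [x0] to the
    ends but not on [u], which is what a family indexed by time requires; the
    inverse of a zero distance is harmless because there are then no points on
    that side. *)
Lemma semiconvex_upper_lipschitz (R : realType) (F a b x0 : R) :
  0 <= F -> a <= x0 <= b -> exists2 K, 0 <= K & forall u du : R -> R,
  {within `[a, b], continuous u} ->
  (forall x, a < x < b -> is_derive x 1 u (du x)) ->
  (forall x, a < x < b -> exists2 d, is_derive x 1 du d & - F <= d) ->
  (forall x, a <= x <= b -> 0 <= u x <= 1) ->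
  forall x, a <= x <= b -> u x <= u x0 + K * `|x - x0|.
Proof.
move=> F0 /andP[ax0 x0b].
have p1 : 0 <= (b - x0)^-1 by rewrite invr_ge0 subr_ge0.
have p2 : 0 <= (x0 - a)^-1 by rewrite invr_ge0 subr_ge0.
pose C := (F + 1) / 2 * (b - a).
have C0 : 0 <= C by rewrite mulr_ge0 //; lra.
exists ((b - x0)^-1 + (x0 - a)^-1 + C); first by rewrite !addr_ge0.
move=> u du uc ud udd u01 x /andP[ax xb].
have [xx0|x0x|->] := ltgtP x x0; last by rewrite subrr normr0 mulr0 addr0.
- have ax0' : a < x0 by exact: le_lt_trans ax xx0.
  have sub : `[a, x0] `<=` `[a, b].
    by move=> y /=; rewrite !in_itv /= => /andP[-> /= H]; exact: le_trans x0b.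
  have ud' y : a < y < x0 -> is_derive y 1 u (du y).
    by move=> /andP[? ?]; apply: ud; apply/andP; split; lra.
  have udd' y : a < y < x0 -> exists2 d, is_derive y 1 du d & - F <= d.
    by move=> /andP[? ?]; apply: udd; apply/andP; split; lra.
  have axx0 : a <= x <= x0 by apply/andP; split; lra.
  have := semiconvex_le_chord ax0' (continuous_subspaceW sub uc) ud' udd' axx0.
  rewrite ltr0_norm ?subr_lt0 //.
  have i0 : 0 < (x0 - a)^-1 by rewrite invr_gt0 subr_gt0.
  have iE : (x0 - a)^-1 * (x0 - a) = 1 by rewrite mulVf //; lra.
  have := u01 a _; rewrite lexx (ltW (lt_le_trans ax0' x0b)) => /(_ isT).
  move=> /andP[ua0 ua1].
  have := u01 x0 _; rewrite ax0 x0b => /(_ isT) /andP[ux0 ux1].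
  set i := (x0 - a)^-1 in i0 iE p2 *.
  have -> : (u x0 - u a) * i * (x - a) + u a =
    u x0 - (u x0 - u a) * (i * (x0 - x)).
    have -> : i * (x0 - x) = i * (x0 - a) - i * (x - a) by ring.
    by rewrite iE; ring.
  have h1 : - (u x0 - u a) * (i * (x0 - x)) <= 1 * (i * (x0 - x)).
    by apply: ler_wpM2r; [apply: mulr_ge0; lra|lra].
  have h2 : (F + 1) / 2 * ((x - a) * (x0 - x)) <= C * (x0 - x).
    rewrite /C -[leRHS]mulrA; apply: ler_wpM2l; first lra.
    by apply: ler_wpM2r; lra.
  have h3 : 0 <= (b - x0)^-1 * (x0 - x) by apply: mulr_ge0 => //; lra.
  lra.
- have x0b' : x0 < b by exact: lt_le_trans x0x xb.
  have sub : `[x0, b] `<=` `[a, b].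
    by move=> y /=; rewrite !in_itv /= => /andP[H ->]; rewrite (le_trans ax0).
  have ud' y : x0 < y < b -> is_derive y 1 u (du y).
    by move=> /andP[? ?]; apply: ud; apply/andP; split; lra.
  have udd' y : x0 < y < b -> exists2 d, is_derive y 1 du d & - F <= d.
    by move=> /andP[? ?]; apply: udd; apply/andP; split; lra.
  have axx0 : x0 <= x <= b by apply/andP; split; lra.
  have := semiconvex_le_chord x0b' (continuous_subspaceW sub uc) ud' udd' axx0.
  rewrite gtr0_norm ?subr_gt0 //.
  have := u01 b _; rewrite lexx (ltW (le_lt_trans ax0 x0b')) => /(_ isT).
  move=> /andP[ub0 ub1].
  have := u01 x0 _; rewrite ax0 x0b => /(_ isT) /andP[ux0 ux1].
  set i := (b - x0)^-1 in p1 *.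
  have h1 : (u b - u x0) * (i * (x - x0)) <= 1 * (i * (x - x0)).
    by apply: ler_wpM2r; [apply: mulr_ge0; lra|lra].
  have h2 : (F + 1) / 2 * ((x - x0) * (b - x)) <= C * (x - x0).
    rewrite /C -[leRHS]mulrA; apply: ler_wpM2l; first lra.
    by rewrite mulrC; apply: ler_wpM2r; lra.
  have h3 : 0 <= (x0 - a)^-1 * (x - x0) by apply: mulr_ge0 => //; lra.
  lra.
Qed.

(** Dini's theorem.  The one-sided bound passes to the limit [v] and makes it
    upper semicontinuous; as the [u t] are continuous and increase with [t], an
    estimate at one point extends to a neighbourhood and to all later times. *)
Lemma increasing_limit_uniform (R : realType) (u : R -> R -> R) (v : R -> R)
    (a b : R) :
  (forall t, {within `[a, b], continuous (u t)}) ->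
  (forall x, a <= x <= b -> forall s t, s <= t -> u s x <= u t x) ->
  (forall x, a <= x <= b -> u t x @[t --> +oo] --> v x) ->
  (forall x0, a <= x0 <= b -> exists2 K, 0 <= K & forall t x, a <= x <= b ->
     u t x <= u t x0 + K * `|x - x0|) ->
  forall e, 0 < e ->
  \forall t \near +oo, forall x, a <= x <= b -> v x <= u t x + e.
Proof.
move=> uc um uv uK e e0.
have /compact_near_coveringP cov := @segment_compact R a b.
pose P (t x : R) := a <= x <= b -> v x <= u t x + e.
suff : \forall t \near +oo, `[a, b] `<=` P t.
  by apply: filterS => t H x axb; apply: H => //=; rewrite in_itv.
apply: cov => x0 /=; rewrite in_itv /= => ax0b.
have [K K0 uK0] := uK x0 ax0b.
have v_le x : a <= x <= b -> v x <= v x0 + K * `|x - x0|.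
  move=> axb; have cvx := uv x axb.
  have <- := cvg_lim (@Rhausdorff R) cvx.
  apply: limr_le; first by apply/cvg_ex; exists (v x).
  near=> t; apply: le_trans (uK0 t x axb) _; rewrite lerD2r.
  have <- := cvg_lim (@Rhausdorff R) (uv x0 ax0b).
  apply: limr_ge; first exact: cvgP (uv x0 ax0b).
  near=> s; apply: um => //; near: s; exact: nbhs_pinfty_ge (num_real t).
have e3 : 0 < e / 3 by rewrite divr_gt0.
have /cvgrPdist_lt/(_ _ e3) := uv x0 ax0b.
move=> /filter_ex[t1]; rewrite ltr_norml => /andP[_ t1e].
have ax0b' : `[a, b]%classic x0 by rewrite /= in_itv.
have nc := within_continuous_near (uc t1) ax0b' e3.
have nK : \forall x \near x0, K * `|x - x0| <= e / 3.
  have d0 : 0 < e / 3 / (K + 1) by rewrite divr_gt0 //; lra.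
  exists (e / 3 / (K + 1)) => //= x; rewrite /ball_ /= distrC => xd.
  apply: le_trans (_ : (K + 1) * (e / 3 / (K + 1)) <= _); last first.
    by rewrite mulrC divfK //; lra.
  by apply: ler_pM => //; [lra|exact: ltW].
exists ([set x | (`[a, b]%classic x -> `|u t1 x - u t1 x0| < e / 3) /\
   K * `|x - x0| <= e / 3], [set t | t1 <= t]) => /=.
  split; last exact: nbhs_pinfty_ge (num_real t1).
  by apply: filterS2 nc nK.
move=> [x t] /= [[H1 H2] tt1] axb.
have := H1; rewrite in_itv /= => /(_ axb); rewrite ltr_norml => /andP[h _].
have := v_le x axb; have := um x axb _ _ tt1; lra.
Unshelve. all: by end_near. Qed.

Lemma near_within_continuous (T : topologicalType) (R : realType) (A : set T)
    (f : T -> R) :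
  (forall x e, A x -> 0 < e -> \forall y \near x, A y -> `|f y - f x| < e) ->
  {within A, continuous f}.
Proof.
move=> H; rewrite continuous_subspace_in => x /set_mem Ax.
apply/cvgrPdist_lt => e e0.
rewrite /prop_near1 {1}/nbhs /= -(nbhs_subspace_in Ax).
have {}H : \forall y \near x, A y -> `|f x - f y| < e.
  by apply: filterS (H x e Ax e0) => y Hy Ay; rewrite distrC; exact: Hy.
exact: H.
Qed.

Lemma compact_min_fin (T : topologicalType) (R : realType) (E : finType)
    (e0 : E) (A : E -> set T) (g : E -> T -> R) :
  (forall e, A e !=set0) -> (forall e, compact (A e)) ->
  (forall e, {within A e, continuous (g e)}) ->
  exists e1 x1, A e1 x1 /\ forall e x, A e x -> g e1 x1 <= g e x.
Proof.
move=> A0 cA cg.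
have : forall e, exists c, A e c /\ forall x, A e x -> g e c <= g e x.
  move=> e; have [c /set_mem Ac cmin] := compact_EVT_min (A0 e) (cA e) (cg e).
  by exists c; split => // x Ax; apply: cmin; exact: mem_set.
move=> /choice[c cmin].
have [e1 _ e1min] := @arg_minP _ _ _ e0 xpredT (fun e => g e (c e)) isT.
exists e1, (c e1); split; first by have [] := cmin e1.
move=> e x Ax; apply: le_trans (e1min e isT) _; have [_] := cmin e; exact.
Qed.

Lemma derivable_mvt (R : realType) (f : R -> R) (a b : R) :
  (forall s, derivable f s 1) -> a <= b ->
  exists2 c, a <= c <= b & f b - f a = f^`()%classic c * (b - a).
Proof.
move=> fd ab.
have fder (x : R) : is_derive x 1 f (f^`()%classic x).
  by rewrite derive1E; apply: derivableP.
have fc : {within `[a, b], continuous f}.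
  by apply: derivable_within_continuous => x _; exact: fd.
have [c] := MVT_segment ab (fun x _ => fder x) fc.
by rewrite in_itv /= => axb ->; exists c.
Qed.

Lemma segment_bounded (R : realType) (g : R -> R) (a b : R) : a <= b ->
  {within `[a, b], continuous g} ->
  exists2 Q, 0 < Q & forall s, a <= s <= b -> `|g s| <= Q.
Proof.
move=> ab gc.
have gac : {within `[a, b], continuous (fun s => `|g s|)}.
  by move=> x; apply: cvg_norm; exact: gc.
have [c _ cmax] := EVT_max ab gac.
exists (`|g c| + 1); first by have := normr_ge0 (g c); lra.
move=> s sab; apply: le_trans (_ : `|g c| <= _); last lra.
by apply: cmax; rewrite in_itv.
Qed.

Lemma segment_unif_continuous (R : realType) (g : R -> R) (a b e : R) :
  continuous g -> 0 < e ->
  exists2 d, 0 < d & forall s t, a <= s <= b -> `|s - t| <= d ->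
    `|g s - g t| <= e.
Proof.
move=> gc e0.
have /compact_near_coveringP cov := @segment_compact R a b.
pose P (d s : R) := forall t, `|s - t| <= d -> `|g s - g t| <= e.
have : \forall d \near 0^'+, `[a, b] `<=` P d.
  apply: cov => x _.
  have e2 : 0 < e / 2 by rewrite divr_gt0.
  have /cvgrPdist_lt/(_ _ e2) /nbhs_ballP[r /= r0 rg] := gc x.
  have r2 : 0 < r / 2 by rewrite divr_gt0.
  exists (ball x (r / 2), [set d | d < r / 2]) => /=.
    split; first exact: nbhsx_ballx.
    exact: nbhs_right_lt.
  move=> [s d] /= [] xs dr t st.
  move: xs; rewrite /ball /= => xs.
  have gs : `|g x - g s| < e / 2 by apply: rg; rewrite /ball /=; lra.
  have gt : `|g x - g t| < e / 2.
    apply: rg; rewrite /ball /=.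
    have -> : x - t = (x - s) + (s - t) by ring.
    by apply: le_lt_trans (ler_normD _ _) _; lra.
  have -> : g s - g t = (g x - g t) - (g x - g s) by ring.
  by apply: le_trans (ler_normB _ _) _; lra.
move=> H; have : \forall d \near 0^'+, 0 < d /\ `[a, b] `<=` P d.
  near=> d; split; last by near: d; exact: H.
  by near: d; exact: nbhs_right_gt.
move=> /filter_ex[d [d0 Hd]]; exists d => // s t sab; apply: Hd => /=.
by rewrite in_itv.
Unshelve. all: by end_near. Qed.

(** * Entire solutions *)

(** Cuts each half-line of the graph at a finite length and keeps the other edges
    whole, so that minima over the graph exist. *)
Definition compact_lengths (R : realType) (G : metric_graph R)
    (len : edge G -> R) : Prop :=
  (forall e, 0 < len e) /\ forall e L w, term G e = Some (L, w) -> len e = L.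

Lemma edge_dom_len (R : realType) (G : metric_graph R) (len : edge G -> R) :
  compact_lengths len -> forall e x, 0 <= x <= len e -> edge_dom e x.
Proof.
move=> [_ lenE] e x /andP[x0 xl]; split => //.
by case H : (term G e) => [[L w]|] //; rewrite -(lenE _ _ _ H).
Qed.

Lemma edge_interior_len (R : realType) (G : metric_graph R) (len : edge G -> R) :
  compact_lengths len -> forall e x, 0 < x < len e -> edge_interior e x.
Proof.
move=> [_ lenE] e x /andP[x0 xl]; split => //.
by case H : (term G e) => [[L w]|] //; rewrite -(lenE _ _ _ H).
Qed.

Lemma edge_interior_dom (R : realType) (G : metric_graph R) (e : edge G) (x : R) :
  edge_interior e x -> edge_dom e x.
Proof.
move=> [x0 xl]; split; first exact: ltW.
by case: term xl => [[L w]|] //; exact: ltW.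
Qed.

Lemma nbhs_edge_interior (R : realType) (G : metric_graph R) (e : edge G) (x : R) :
  edge_interior e x -> \forall y \near x, edge_interior e y.
Proof.
move=> [x0 xl]; rewrite /edge_interior.
case: term xl => [[L w]|] H /=.
  near=> y; split; near: y; [exact: lt_nbhsr|exact: lt_nbhsl].
by near=> y; split => //; near: y; exact: lt_nbhsr.
Unshelve. all: by end_near. Qed.

Lemma continuous_slice (R : realType) (A : set R) (w : R -> R -> R) (t : R) :
  {within [set p : R * R | A p.2], continuous (fun p : R * R => w p.1 p.2)} ->
  {within A, continuous (w t)}.
Proof.
move=> wc; apply: near_within_continuous => x e Ax e0.
have := @within_continuous_near _ _ [set p : R * R | A p.2]
  (fun p : R * R => w p.1 p.2) (t, x) e wc Ax e0.
move=> [[U V] /= [Ut Vx] UV].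
apply: filterS Vx => y Vy Ay; apply: (UV (t, y)) => //=; split => //.
exact: nbhs_singleton.
Qed.

(** A solution that increases in time is, at each time, a subsolution of the
    stationary equation. *)
Lemma entire_solution_interior (R : realType) (G : metric_graph R) (f : R -> R)
    (u ux : R -> graph_fun G) :
  increasing_in_time u ->
  (forall (t : R) (e : edge G) (x : R), edge_interior e x ->
     exists ut uxx : R, [/\ is_derive t 1 (fun s => u s e x) ut,
       is_derive x 1 (ux t e) uxx & ut = uxx + f (u t e x)]) ->
  forall t e x, edge_interior e x ->
  exists2 d, is_derive x 1 (ux t e) d & - f (u t e x) <= d.
Proof.
move=> um H t e x xi; have [ut [uxx [Ht Hx E]]] := H t e x xi.
exists uxx => //; suff : 0 <= ut by lra.
apply: (@rslope_ge0 _ (fun s => u s e x) t (t + 1)).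
- by rewrite ltrDl.
- by move=> s /andP[ts _]; apply/ltW/um => //; exact: edge_interior_dom.
- exact: is_derive_rslope.
Qed.

Lemma limit_profile_cvg (R : realType) (G : metric_graph R)
    (u : R -> graph_fun G) (e : edge G) (x : R) :
  (forall t, 0 < u t e x < 1) -> increasing_in_time u -> edge_dom e x ->
  [/\ u t e x @[t --> +oo] --> limit_profile u e x,
      forall t, u t e x < limit_profile u e x & limit_profile u e x <= 1].
Proof.
move=> u01 um xd.
have mono : nondecreasing_fun (fun t => u t e x).
  move=> s t; rewrite le_eqVlt => /predU1P[->//|st].
  exact/ltW/um.
have ub : has_ubound (range (fun t => u t e x)).
  by exists 1 => _ [t _ <-]; have /andP[_ /ltW] := u01 t.
have cu := nondecreasing_cvgr mono ub.
have vE : limit_profile u e x = sup (range (fun t => u t e x)).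
  exact: cvg_lim cu.
split.
- by rewrite vE.
- move=> t; apply: (@lt_le_trans _ _ (u (t + 1) e x)).
    by apply: um => //; rewrite ltrDl.
  by rewrite vE; apply: sup_upper_bound; [split => //; exists (u t e x), t|exists (t + 1)].
- rewrite vE; apply: sup_le_ub; first by exists (u 0 e x), 0.
  by move=> _ [t _ <-]; have /andP[_ /ltW] := u01 t.
Qed.

(** By the equation, [u] is semiconvex in space with a constant that bounds [f] on
    the unit interval, uniformly in time. *)
Lemma limit_profile_uniform (R : realType) (G : metric_graph R) (f : R -> R)
    (u : R -> graph_fun G) (len : edge G -> R) :
  (forall s, derivable f s 1) -> entire_solution f u ->
  (forall t (e : edge G) x, edge_dom e x -> 0 < u t e x < 1) ->
  increasing_in_time u -> compact_lengths len ->
  forall e0, 0 < e0 -> \forall t \near +oo, forall e x, 0 <= x <= len e ->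
    limit_profile u e x <= u t e x + e0.
Proof.
move=> fd [uc [_ [ux [uD uxc pde _]]]] u01 um lenP e0 e00.
have fc : {within `[0, 1], continuous f}.
  by apply: derivable_within_continuous => x _; exact: fd.
have [F F0 Ff] := segment_bounded ler01 fc.
apply: filter_forall => e.
have len0 := lenP.1 e.
have dom x : 0 <= x <= len e -> edge_dom e x by exact: edge_dom_len.
have sub : `[0, len e] `<=` edge_dom e.
  by move=> x /=; rewrite in_itv /=; exact: dom.
apply: (increasing_limit_uniform (u := fun t => u t e)) => //.
- move=> t; apply: continuous_subspaceW sub _.
  by have := uc e => /(@continuous_slice _ (edge_dom e) (fun t x => u t e x) t).
- move=> x /dom xd s t; rewrite le_eqVlt => /predU1P[->//|st].
  exact/ltW/um.
- move=> x /dom xd.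
  by have [] := @limit_profile_cvg _ _ u e x (fun t => u01 t e x xd) um xd.
- move=> x0 x0len.
  have [K K0 HK] := semiconvex_upper_lipschitz (ltW F0) x0len.
  exists K => // t; apply: (HK (u t e) (ux t e)).
  + apply: continuous_subspaceW sub _.
    by have := uc e => /(@continuous_slice _ (edge_dom e) (fun t x => u t e x) t).
  + move=> x xl; have xi := edge_interior_len lenP xl.
    apply: (@is_derive_of_within _ (edge_dom e)).
      by apply: filterS (nbhs_edge_interior xi) => y; exact: edge_interior_dom.
    by apply: uD; exact: edge_interior_dom.
  + move=> x xl; have xi := edge_interior_len lenP xl.
    have [d dd fd'] := entire_solution_interior um pde t xi.
    exists d => //; apply: le_trans fd'; rewrite lerN2.
    apply: le_trans (ler_norm _) _; apply: Ff.
    by have /andP[/ltW-> /ltW->] := u01 t e x (edge_interior_dom xi).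
  + by move=> x /dom xd; have /andP[/ltW-> /ltW->] := u01 t e x xd.
Qed.

(** * The sliding argument *)

(** The sum that the Kirchhoff condition equates to zero. *)
Definition flux (R : realType) (G : metric_graph R) (dg : graph_fun G)
    (v : vertex G) : R :=
  \sum_(e : edge G) thickness G e *
    ((if orig G e == v then dg e 0 else 0)
     + (if term G e is Some (L, w) then if w == v then - dg e L else 0
        else 0)).

Lemma flux_lin (R : realType) (G : metric_graph R) (a b : graph_fun G) (c : R)
    (v : vertex G) :
  flux (fun e x => a e x + c * b e x) v = flux a v + c * flux b v.
Proof.
rewrite /flux mulr_sumr -big_split /=; apply: eq_bigr => e _.
by case: (orig G e == v); case: (term G e) => [[L w]|] //;
  try case: (w == v); ring.
Qed.

Definition kink (R : realType) (g : R -> R) (x : R) : Prop :=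
  exists dl dr, [/\ lslope g x dl, rslope g x dr & dl < dr].

(** At [x], [g] satisfies [g'' + q * g >= delta * g]. *)
Definition smooth_subsolution (R : realType) (q delta : R) (g : R -> R) (x : R) :
    Prop :=
  exists (dg : R -> R) (d : R), [/\ \forall y \near x, is_derive (y : R) 1 g (dg y),
    is_derive x 1 dg d & delta * g x <= d + q * g x].

(** All slopes that point into the edges are nonnegative at a minimum. *)
Lemma flux_ge0_at_min (R : realType) (G : metric_graph R) (g dg : graph_fun G)
    (len : edge G -> R) (e : edge G) (x : R) (v : vertex G) :
  (forall e, 0 < thickness G e) -> compact_lengths len -> single_valued g ->
  at_vertex e x v -> (forall e' y, 0 <= y <= len e' -> g e x <= g e' y) ->
  (forall e', rslope (g e') 0 (dg e' 0)) ->
  (forall e' L w, term G e' = Some (L, w) -> lslope (g e') L (dg e' L)) ->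
  0 <= flux dg v.
Proof.
move=> th0 [len0 lenE] [gv gvE] xv gmin gr gl.
apply: sumr_ge0 => e' _; apply: mulr_ge0; first exact: ltW.
apply: addr_ge0.
- case: eqP => // ov.
  apply: (rslope_ge0 (len0 e') _ (gr e')) => y /andP[y0 yl].
  have -> : g e' 0 = g e x.
    by rewrite (gvE e x v xv); apply: gvE; left.
  by apply: gmin; rewrite !ltW.
- case H : (term G e') => [[L w]|] //; case: eqP => // wv; subst w.
  have lE := lenE _ _ _ H.
  have L0 : 0 < L by rewrite -lE.
  rewrite oppr_ge0; apply: (lslope_le0 L0 _ (gl _ _ _ H)) => y /andP[y0 yl].
  have -> : g e' L = g e x.
    by rewrite (gvE e x v xv); apply: gvE; right.
  by apply: gmin; rewrite lE !ltW.
Qed.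

Lemma single_valued_lin (R : realType) (G : metric_graph R) (a b : graph_fun G)
    (c : R) :
  single_valued a -> single_valued b ->
  single_valued (fun e x => a e x + c * b e x : R).
Proof.
move=> [av avE] [bv bvE]; exists (fun v => av v + c * bv v) => e x v xv.
by rewrite (avE _ _ _ xv) (bvE _ _ _ xv).
Qed.

Lemma second_derivative_min_diff (R : realType) (g1 dg1 g0 dg0 z dz : R -> R)
    (s x d1 d0 d : R) :
  (\forall y \near x, [/\ is_derive (y : R) 1 g1 (dg1 y), is_derive (y : R) 1 g0 (dg0 y)
     & is_derive (y : R) 1 z (dz y)]) ->
  is_derive x 1 dg1 d1 -> is_derive x 1 dg0 d0 -> is_derive x 1 dz d ->
  (\forall y \near x, g1 x + -1 * g0 x + - s * z x <= g1 y + -1 * g0 y + - s * z y) ->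
  0 <= d1 - d0 - s * d.
Proof.
move=> gd gd1 gd0 zd gmin.
have -> : d1 - d0 - s * d = d1 + -1 * d0 + - s * d by ring.
apply: (@second_derivative_min _ (fun y => g1 y + -1 * g0 y + - s * z y)
  (fun y => dg1 y + -1 * dg0 y + - s * dz y) x) gmin.
apply: filterS gd => y [h1 h0 hz].
exact: is_derive_lin (is_derive_lin (-1) h1 h0) hz.
Qed.

Lemma continuous_within_snd (R : realType) (A B : set R) (w : R -> R) :
  {within B, continuous w} ->
  {within A `*` B, continuous (fun p : R * R => w p.2)}.
Proof.
move=> wc; apply: near_within_continuous => -[t x] e [/= _ Bx] e0.
have H := within_continuous_near wc Bx e0.
exists (setT, [set y | B y -> `|w y - w x| < e]) => /=.
  by split => //; exact: filterT.
by move=> [s y] /= [_ Hy] [_ By]; exact: Hy.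
Qed.

(** The supremum of the admissible multiples is admissible, and any larger
    multiple fails somewhere; this failure is the approximate contact. *)
Lemma largest_multiple_below (R : realType) (E : Type) (K : set (E * R))
    (w z : E * R -> R) (Z : R) : 0 < Z ->
  (forall p, K p -> 0 <= w p) -> (forall p, K p -> 0 <= z p <= Z) ->
  (exists2 p, K p & 0 < z p) ->
  exists s, [/\ 0 <= s, forall p, K p -> s * z p <= w p &
    forall eps, 0 < eps -> exists2 p, K p & w p < s * z p + eps].
Proof.
move=> Z0 w0 zZ [p0 Kp0 zp0].
pose S := [set s : R | forall p, K p -> s * z p <= w p].
have S0 : S 0 by move=> p Kp; rewrite mul0r; exact: w0.
have Sub : ubound S (w p0 / z p0) by move=> s /(_ p0 Kp0); rewrite ler_pdivlMr.
have supS : has_sup S by split; [exists 0|exists (w p0 / z p0)].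
exists (sup S); split; first exact: sup_upper_bound.
- move=> p Kp; have /andP[+ _] := zZ p Kp.
  rewrite le_eqVlt => /predU1P[<-|zp]; first by rewrite mulr0 w0.
  rewrite -ler_pdivlMr //; apply: sup_le_ub; first by exists 0.
  by move=> s /(_ p Kp); rewrite ler_pdivlMr.
- move=> eps eps0; apply: contrapT => H.
  have : S (sup S + eps / Z).
    move=> p Kp; have h1 : sup S * z p + eps <= w p.
      by rewrite leNgt; apply/negP => h; apply: H; exists p.
    apply: le_trans h1; rewrite mulrDl lerD2l mulrAC ler_pdivrMr //.
    by apply: ler_wpM2l; [exact: ltW|have /andP[] := zZ p Kp].
  move=> /(sup_upper_bound supS); rewrite leNgt ltrDl divr_gt0 //.
Qed.

(** Minimizing [u - h - eta * t] over a time interval of length [3 / eta] rather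
    than [u - h] keeps the minimum away from the initial time, because [u] ranges
    over an interval of length 1; at the minimum [u] grows at rate at most
    [eta]. *)
Lemma tilted_min (R : realType) (E : finType) (e0 : E) (len : E -> R)
    (u : R -> E -> R -> R) (h : E -> R -> R) (T eta : R) :
  0 < eta -> (forall e, 0 < len e) ->
  (forall e, {within [set p : R * R | 0 <= p.2 <= len e],
     continuous (fun p : R * R => u p.1 e p.2)}) ->
  (forall e, {within `[0, len e], continuous (h e)}) ->
  (forall t e x, 0 <= x <= len e -> 0 < u t e x < 1) ->
  exists t1 e1 x1, [/\ T < t1, 0 <= x1 <= len e1,
    forall t, T < t < t1 -> u t1 e1 x1 + - eta * t1 <= u t e1 x1 + - eta * t
    & forall e x, 0 <= x <= len e -> u t1 e1 x1 - h e1 x1 <= u t1 e x - h e x].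
Proof.
move=> eta0 len0 uc hc u01.
pose T' := T + 3 / eta.
have TT' : T < T' by rewrite ltrDl divr_gt0.
pose g e (p : R * R) := u p.1 e p.2 - h e p.2 - eta * p.1.
pose A e : set (R * R) := `[T, T'] `*` `[0, len e].
have [e1 [[t1 x1] [/= []]]] : exists e1 p, A e1 p /\ forall e q, A e q -> g e1 p <= g e q.
  apply: (compact_min_fin e0).
  - by move=> e; exists (T, 0); split; rewrite /= in_itv /= lexx ltW.
  - by move=> e; apply: compact_setX; exact: segment_compact.
  - move=> e p; apply: cvgB; first apply: cvgB.
    + suff : {within A e, continuous (fun p : R * R => u p.1 e p.2)} by apply.
      by apply: continuous_subspaceW (uc e) => -[t x] [_]; rewrite /= in_itv.
    + suff : {within A e, continuous (fun p : R * R => h e p.2)} by apply.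
      exact: continuous_within_snd.
    + apply: cvgM; first exact: cvg_cst.
      suff : {within A e, continuous (fun p : R * R => p.1)} by apply.
      by apply: continuous_subspaceT => q; exact: cvg_fst.
rewrite /= !in_itv /= => /andP[Tt1 t1T'] x1l gmin.
have {}gmin t e x : T <= t <= T' -> 0 <= x <= len e -> g e1 (t1, x1) <= g e (t, x).
  by move=> tT xl; apply: gmin; split; rewrite /= in_itv.
exists t1, e1, x1; split => //.
- rewrite lt_neqAle Tt1 andbT; apply/eqP => TE.
  have := gmin T' e1 x1; rewrite lexx (ltW TT') => /(_ isT x1l).
  rewrite /g /= -TE /T' mulrDr [eta * (3 / eta)]mulrC divfK ?gt_eqF //.
  have := u01 T _ _ x1l; have := u01 (T + 3 / eta) _ _ x1l.
  by clear; move=> /andP[? ?] /andP[? ?]; lra.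
- move=> t /andP[Tt tt1].
  have := gmin t e1 x1; rewrite (ltW Tt) (le_trans (ltW tt1) t1T').
  by move=> /(_ isT x1l); rewrite /g /=; clear; lra.
- move=> e x xl; have := gmin t1 e x; rewrite Tt1 t1T' => /(_ isT xl).
  by rewrite /g /=; clear; lra.
Qed.

(** [u1] is [u0 + h] up to [eps]: the mean value theorem between [u0] and [u0 + h]
    gives the term in [k], and between [u0 + h] and [u1] the error [Q * eps]. *)
Lemma reaction_gap (R : realType) (f : R -> R) (Q eps k u0 u1 h : R) :
  (forall s, derivable f s 1) -> 0 <= Q ->
  (forall s, 0 <= s <= 1 -> `|f^`()%classic s| <= Q) ->
  0 <= u0 -> 0 <= h -> u0 + h <= 1 -> 0 <= u1 <= 1 ->
  u0 + h - eps <= u1 <= u0 + h + eps ->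
  (forall c, u0 <= c <= u0 + h -> k <= f^`()%classic c) ->
  k * h - Q * eps <= f u1 - f u0.
Proof.
move=> fd Q0 f'Q u00 h0 h1 /andP[u10 u11] /andP[lo hi] fk.
have f0 : k * h <= f (u0 + h) - f u0.
  have uh : u0 <= u0 + h by rewrite lerDl.
  have [c ch ->] := derivable_mvt fd uh.
  rewrite addrAC subrr add0r; apply: ler_wpM2r => //; exact: fk.
have lip a b : 0 <= a -> a <= b -> b <= 1 -> b - a <= eps ->
    `|f b - f a| <= Q * eps.
  move=> a0 ab b1 ba; have [c /andP[ac cb] ->] := derivable_mvt fd ab.
  rewrite normrM [`|b - a|]ger0_norm ?subr_ge0 //; apply: ler_pM => //.
    by rewrite subr_ge0.
  by apply: f'Q; rewrite (le_trans a0) // (le_trans cb).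
suff : f (u0 + h) - Q * eps <= f u1 by move: f0; clear; lra.
have [le|/ltW le] := leP (u0 + h) u1.
- have := lip _ _ (addr_ge0 u00 h0) le u11; rewrite ler_norml => H.
  have {H}/andP[H _] := H ltac:(move: hi; clear; lra).
  by move: H; clear; lra.
- have := lip _ _ u10 le h1; rewrite ler_norml => H.
  have {H}/andP[_ H] := H ltac:(move: lo; clear; lra).
  by move: H; clear; lra.
Qed.

(** The limit profile [v] is stable from below.  Let [s * zeta] be the largest
    multiple of [zeta] that fits between [u] at a late time [t0] and [v], and let
    [chi] be the sum of [u] at time [t0] and [s * zeta].  Since [u] at time [t0]
    is a subsolution of the nonlinear equation close to [v], and [zeta] is a
    strict subsolution of the equation linearized at [v], [chi] is a strict
    subsolution wherever [s * zeta] is bounded below.  Now [chi <= v], with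
    approximate contact, while [u] increases to [v] uniformly.  So the minimum of
    [u - chi] at late times is small, and there [s * zeta] is at least half the
    amount [mu] that [u] has gained since [t0].  At an interior minimum strictness
    makes [u] grow at a rate bounded below, which is impossible for a bounded
    function; at a vertex or at a convex kink the slopes are incompatible. *)
Lemma no_strict_subsolution (R : realType) (f : R -> R) (G : metric_graph R)
    (u : R -> graph_fun G) (len : edge G -> R) (zeta dzeta : graph_fun G)
    (delta : R) :
  (forall s, derivable f s 1) -> continuous f^`()%classic ->
  (forall e, 0 < thickness G e) -> entire_solution f u ->
  (forall t (e : edge G) x, edge_dom e x -> 0 < u t e x < 1) ->
  increasing_in_time u -> compact_lengths len -> 0 < delta ->
  (forall e, {within `[0, len e], continuous (zeta e)}) ->
  single_valued zeta ->
  (forall e x, 0 <= x <= len e -> 0 <= zeta e x) ->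
  (exists e, exists2 x, 0 <= x <= len e & 0 < zeta e x) ->
  (forall e, term G e = None -> zeta e (len e) = 0) ->
  (forall e x, 0 < x < len e -> kink (zeta e) x \/
    smooth_subsolution (f^`()%classic (limit_profile u e x)) delta (zeta e) x) ->
  (forall e, rslope (zeta e) 0 (dzeta e 0)) ->
  (forall e L w, term G e = Some (L, w) -> lslope (zeta e) L (dzeta e L)) ->
  (forall v, 0 < flux dzeta v) -> False.
Proof.
move=> fd f'c th0 usol u01 um lenP delta0 zc zs z0 [ez [xz xzl zpos]] zend zsub
  zr zl zflux.
pose v := limit_profile u.
have [uc [us [ux [uD uxc pde kir]]]] := usol.
have [len0 lenE] := lenP.
have dom e x : 0 <= x <= len e -> edge_dom e x by exact: edge_dom_len.
have sub e : `[0, len e] `<=` edge_dom e.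
  by move=> x /=; rewrite in_itv /=; exact: dom.
have vP t e x : 0 <= x <= len e -> [/\ 0 < u t e x, u t e x < v e x & v e x <= 1].
  move=> /dom xd; have [_ h1 h2] := limit_profile_cvg (fun t => u01 t e x xd) um xd.
  by split => //; have /andP[] := u01 t e x xd.
have uct t e : {within `[0, len e], continuous (u t e)}.
  apply: continuous_subspaceW (sub e) _.
  by have := uc e => /(@continuous_slice _ (edge_dom e) (fun t x => u t e x) t).
have [Q Q0 f'Q] := segment_bounded ler01 (continuous_subspaceT f'c).
have delta2 : 0 < delta / 2 by rewrite divr_gt0.
have [eps0 eps00 f'u] := segment_unif_continuous 0 1 f'c delta2.
have /filter_ex[t0 vt0] := limit_profile_uniform fd usol u01 um lenP eps00.
have A0 e : (`[0, len e]%classic : set R) !=set0.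
  by exists 0; rewrite /= in_itv /= lexx ltW.
have cA e : compact (`[0, len e]%classic : set R) by exact: segment_compact.
have [mu mu0 umu] : exists2 mu, 0 < mu & forall e x, 0 <= x <= len e ->
    u t0 e x + mu <= u (t0 + 1) e x.
  have gc e : {within `[0, len e], continuous
      (fun x => u (t0 + 1) e x + -1 * u t0 e x)}.
    move=> x; apply: cvgD; first exact: uct.
    by apply: cvgM; [exact: cvg_cst|exact: uct].
  have [e1 [x1 [x1l x1min]]] := compact_min_fin ez A0 cA gc.
  exists (u (t0 + 1) e1 x1 + -1 * u t0 e1 x1).
    move: x1l; rewrite /= in_itv /= => /dom x1d.
    by have := um e1 x1 x1d t0 (t0 + 1); rewrite ltrDl ltr01 => /(_ isT); lra.
  move=> e x xl; have := x1min e x; rewrite /= in_itv /= => /(_ xl); lra.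
have [Z Z0 zZ] : exists2 Z, 0 < Z & forall e x, 0 <= x <= len e -> zeta e x <= Z.
  have gc e : {within `[0, len e], continuous (fun x => - zeta e x)}.
    by move=> x; apply: cvgN; exact: zc.
  have [e1 [x1 [_ x1min]]] := compact_min_fin ez A0 cA gc.
  have H e x : 0 <= x <= len e -> zeta e x <= zeta e1 x1.
    by move=> xl; have := x1min e x; rewrite /= in_itv /= lerN2; exact.
  by exists (zeta e1 x1) => //; apply: lt_le_trans zpos (H _ _ xzl).
pose K : set (edge G * R) := [set p | 0 <= p.2 <= len p.1].
have [s0 [s0_ge0 s0S touch]] : exists s, [/\ 0 <= s,
    forall p, K p -> s * zeta p.1 p.2 <= v p.1 p.2 - u t0 p.1 p.2 &
    forall eps, 0 < eps -> exists2 p, K p &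
      v p.1 p.2 - u t0 p.1 p.2 < s * zeta p.1 p.2 + eps].
  apply: (largest_multiple_below Z0) => [p Kp|p Kp|].
  - by have [_ /ltW ? _] := vP t0 _ _ Kp; rewrite subr_ge0.
  - by rewrite z0 // zZ.
  - by exists (ez, xz).
(* At the minimum the excess of chi is worth delta * mu / 4, that is 4 * eta; the
   rate eta of the tilt and the error Q * eps <= eta leave a contradiction. *)
pose eta := delta * mu / 16.
have eta0 : 0 < eta by rewrite divr_gt0 // mulr_gt0.
pose eps := Num.min (eta / Q) (mu / 2).
have eps_gt0 : 0 < eps by rewrite lt_min; apply/andP; split; exact: divr_gt0.
have Qeps : Q * eps <= eta.
  by rewrite mulrC -ler_pdivlMr // ge_min lexx.
have eps_mu : eps <= mu / 2 by rewrite ge_min lexx orbT.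
have [T [vT Tt0]] : exists T, (forall e x, 0 <= x <= len e ->
    v e x <= u T e x + eps) /\ t0 + 1 <= T.
  apply: (@filter_ex _ (pinfty_nbhs R)); apply: filterI.
    exact: limit_profile_uniform fd usol u01 um lenP _ eps_gt0.
  exact: nbhs_pinfty_ge (num_real _).
pose chi e x := u t0 e x + s0 * zeta e x.
have chic e : {within `[0, len e], continuous (chi e)}.
  move=> x; apply: cvgD; first exact: uct.
  by apply: cvgM; [exact: cvg_cst|exact: zc].
have ucK e : {within [set p : R * R | 0 <= p.2 <= len e],
    continuous (fun p : R * R => u p.1 e p.2)}.
  by apply: continuous_subspaceW (uc e) => -[t x]; exact: dom.
have [t1 [e1 [x1 [T_lt_t1 x1l tmin chimin]]]] :=
  tilted_min ez T eta0 len0 ucK chic (fun t e x xl => u01 t e x (dom e x xl)).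
have u_mono s t e x : 0 <= x <= len e -> s <= t -> u s e x <= u t e x.
  by move=> /dom xd; rewrite le_eqVlt => /predU1P[->//|st]; exact/ltW/um.
have wmin e x : 0 <= x <= len e -> u t1 e1 x1 + -1 * u t0 e1 x1 + - s0 * zeta e1 x1
    <= u t1 e x + -1 * u t0 e x + - s0 * zeta e x.
  by move=> /chimin; rewrite /chi; clear; lra.
have u_hi : u t1 e1 x1 <= u t0 e1 x1 + s0 * zeta e1 x1 + eps.
  have [[e x] xl vx] := touch eps eps_gt0.
  have [_ uv _] := vP t1 e x xl.
  by move: vx uv (wmin e x xl); rewrite /=; clear; lra.
have u_lo : u t0 e1 x1 + s0 * zeta e1 x1 <= u t1 e1 x1 + eps.
  move: (s0S (e1, x1) x1l) (vT e1 x1 x1l) (u_mono _ _ e1 x1 x1l (ltW T_lt_t1)).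
  by rewrite /=; clear; lra.
have z_mu : mu / 2 <= s0 * zeta e1 x1.
  move: (umu e1 x1 x1l) (u_mono _ _ e1 x1 x1l (le_trans Tt0 (ltW T_lt_t1))).
  by move: u_hi eps_mu; clear; lra.
have s0_gt0 : 0 < s0.
  rewrite lt_neqAle s0_ge0 andbT; apply/eqP => s00.
  by move: z_mu mu0; rewrite -s00 mul0r; clear; lra.
have vertex_case w : at_vertex e1 x1 w -> False.
  move=> xw; pose dw e x := ux t1 e x + -1 * ux t0 e x + - s0 * dzeta e x.
  pose ww e x := u t1 e x + -1 * u t0 e x + - s0 * zeta e x.
  have ws : single_valued (ww : graph_fun G).
    by apply: single_valued_lin => //; apply: single_valued_lin; exact: us.
  have ur t e : rslope (u t e) 0 (ux t e 0).
    apply: (@is_derive_within_rslope _ (edge_dom e) _ _ (len e)) => //.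
      by move=> y /andP[? ?]; apply: dom; rewrite !ltW.
    by apply: uD; apply: dom; rewrite lexx ltW.
  have ul t e L w' : term G e = Some (L, w') -> lslope (u t e) L (ux t e L).
    move=> /lenE lE.
    apply: (@is_derive_within_lslope _ (edge_dom e) _ _ 0); rewrite -?lE //.
      by move=> y /andP[? ?]; apply: dom; rewrite !ltW.
    by apply: uD; apply: dom; rewrite lexx ltW.
  have : 0 <= flux (dw : graph_fun G) w.
    apply: (flux_ge0_at_min th0 lenP ws xw wmin).
      by move=> e; apply: rslope_lin => //; apply: rslope_lin.
    by move=> e L w' H; apply: lslope_lin; [apply: lslope_lin|]; eauto.
  rewrite /dw !flux_lin.
  have -> : flux (ux t1) w = 0 by exact: kir.
  have -> : flux (ux t0) w = 0 by exact: kir.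
  have := mulr_gt0 s0_gt0 (zflux w).
  by clear; lra.
have x1d := dom _ _ x1l.
case: (eqVneq x1 0) => [x10|x1n0].
  by apply: (vertex_case (orig G e1)); left.
case: (eqVneq x1 (len e1)) => [x1len|x1nl].
  case H : (term G e1) => [[L w]|].
    by apply: (vertex_case w); right; rewrite H x1len (lenE _ _ _ H).
  by move: z_mu; rewrite x1len (zend _ H) mulr0; move: mu0; clear; lra.
have /andP[x10 x1len] := x1l.
have {}x10 : 0 < x1 by rewrite lt_neqAle eq_sym x1n0.
have {}x1len : x1 < len e1 by rewrite lt_neqAle x1nl.
have x1i : edge_interior e1 x1 by apply: (edge_interior_len lenP); rewrite x10.
have uder t x : edge_interior e1 x -> is_derive x 1 (u t e1) (ux t e1 x).
  move=> xi; apply: (@is_derive_of_within _ (edge_dom e1)).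
    by apply: filterS (nbhs_edge_interior xi) => y; exact: edge_interior_dom.
  by apply: uD; exact: edge_interior_dom.
have x1in : 0 < x1 < len e1 by rewrite x10.
have [[dl [dr [zdl zdr dlr]]]|[dz [d2 [zd zd2 zineq]]]] := zsub e1 x1 x1in.
- (* a convex kink of zeta cannot touch a differentiable function from below *)
  have ur t := is_derive_rslope (uder t x1 x1i).
  have ul t := is_derive_lslope (uder t x1 x1i).
  have h1 : 0 <= ux t1 e1 x1 + -1 * ux t0 e1 x1 + - s0 * dr.
    apply: (rslope_ge0 x1len _ (rslope_lin (c := - s0) (rslope_lin (c := -1) (ur t1) (ur t0)) zdr)).
    by move=> y /andP[yl yr]; apply: wmin; apply/andP; split; move: x10 x1len yl yr; clear; lra.
  have h2 : ux t1 e1 x1 + -1 * ux t0 e1 x1 + - s0 * dl <= 0.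
    apply: (lslope_le0 x10 _ (lslope_lin (c := - s0) (lslope_lin (c := -1) (ul t1) (ul t0)) zdl)).
    by move=> y /andP[yl yr]; apply: wmin; apply/andP; split; move: x10 x1len yl yr; clear; lra.
  have : 0 < s0 * (dr - dl) by rewrite mulr_gt0 // subr_gt0.
  by move: h1 h2; clear; lra.
have [ut [uxx [Ht Hx E]]] := pde t1 e1 x1 x1i.
have [uxx0 Hx0 E0] := entire_solution_interior um pde t0 x1i.
have ut_eta : ut <= eta.
  suff : ut + - eta * 1 <= 0 by clear; lra.
  exact: (lslope_le0 T_lt_t1 tmin
    (lslope_lin (is_derive_lslope Ht) (is_derive_lslope (is_derive_id t1 1)))).
have H2 : 0 <= uxx - uxx0 - s0 * d2.
  apply: (second_derivative_min_diff _ Hx Hx0 zd2).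
    apply: filterS2 zd (nbhs_edge_interior x1i) => y zdy yi.
    by split; [exact: uder|exact: uder|exact: zdy].
  by apply: filterS (near_itvoo x1in) => y /andP[? ?]; apply: wmin; rewrite !ltW.
have [u0pos u0v vle1] := vP t0 _ _ x1l.
have [u1pos u1v _] := vP t1 _ _ x1l.
set h := s0 * zeta e1 x1 in z_mu u_hi u_lo *.
have h_ge0 : 0 <= h by apply: le_trans z_mu; rewrite divr_ge0 // ltW.
have chi_v : u t0 e1 x1 + h <= v e1 x1.
  by have := s0S (e1, x1) x1l; rewrite /= -/h; clear; lra.
set q := f^`()%classic (limit_profile u e1 x1) in zineq.
have gap : (q - delta / 2) * h - Q * eps <= f (u t1 e1 x1) - f (u t0 e1 x1).
  apply: reaction_gap => //; try exact: ltW.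
  - exact: le_trans chi_v vle1.
  - by rewrite (ltW u1pos) (ltW (lt_le_trans u1v vle1)).
  - by rewrite lerBlDr u_lo u_hi.
  - move=> c /andP[c0 ch].
    have vc : `|v e1 x1 - c| <= eps0.
      rewrite ger0_norm; last by rewrite subr_ge0 (le_trans ch).
      by have := vt0 e1 x1 x1l; rewrite -/v; move: c0; clear; lra.
    have v01 : 0 <= v e1 x1 <= 1 by rewrite vle1 (ltW (lt_trans u0pos u0v)).
    have := f'u _ _ v01 vc; rewrite -/q ler_norml => /andP[_].
    by clear; lra.
have f2 : s0 * (delta * zeta e1 x1) <= s0 * (d2 + q * zeta e1 x1).
  by apply: ler_wpM2l.
have hd : delta * (mu / 2) <= delta * h by rewrite ler_pM2l.
have e1' : s0 * (delta * zeta e1 x1) = delta * h by rewrite /h; ring.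
have e2' : s0 * (d2 + q * zeta e1 x1) = s0 * d2 + q * h by rewrite /h; ring.
have e3' : (q - delta / 2) * h = q * h - delta * h / 2 by field.
have e4' : delta * (mu / 2) = 8 * eta by rewrite /eta; field.
rewrite e1' e2' in f2; rewrite e3' in gap; rewrite e4' in hd.
move: gap f2 hd Qeps ut_eta H2 E eta0 E0; clear; lra.
Qed.

(** * Barriers on an edge *)

(** [x * exp (M * x)], normalized to be 1 at [L]: it vanishes at 0 with a positive
    slope, and its second derivative is at least [M ^+ 2] times itself. *)
Definition rise (R : realType) (M L x : R) : R :=
  (L * expR (M * L))^-1 * (x * expR (M * x)).

Definition drise (R : realType) (M L x : R) : R :=
  (L * expR (M * L))^-1 * ((1 + M * x) * expR (M * x)).

Definition d2rise (R : realType) (M L x : R) : R :=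
  (L * expR (M * L))^-1 * ((2 * M + M * M * x) * expR (M * x)).

Lemma is_derive_expM (R : realType) (M x : R) :
  is_derive x 1 (fun y => expR (M * y)) (M * expR (M * x)).
Proof.
have h : is_derive x 1 (fun y => M * y) M.
  have := is_derive_affine x 0 M; congr (is_derive x 1 _ M).
  by apply/funext => y; rewrite add0r.
have := @is_derive1_comp _ expR (fun y => M * y) x _ _ (is_derive_expR (M * x)) h.
by rewrite mulrC.
Qed.

Lemma is_derive_affine_exp (R : realType) (C A B M x : R) :
  is_derive x 1 (fun y => C * ((A + B * y) * expR (M * y)))
    (C * ((B + M * A + M * B * x) * expR (M * x))).
Proof.
have h := is_derive_mul_fun (is_derive_affine x A B) (is_derive_expM M x).
have := is_derive_lin C (is_derive_cst (0 : R) x (1 : R)) h.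
have -> : (fun y : R => 0 + C * ((A + B * y) * expR (M * y))) =
          (fun y => C * ((A + B * y) * expR (M * y))).
  by apply/funext => y; rewrite add0r.
by move=> h2; apply: (is_derive_eq h2); ring.
Qed.

Lemma is_derive_rise (R : realType) (M L x : R) :
  is_derive x 1 (rise M L) (drise M L x).
Proof.
have := is_derive_affine_exp (L * expR (M * L))^-1 0 1 M x.
have -> : (fun y => (L * expR (M * L))^-1 * ((0 + 1 * y) * expR (M * y))) = rise M L.
  by apply/funext => y; rewrite add0r mul1r.
by move=> h; apply: (is_derive_eq h); rewrite /drise; ring.
Qed.

Lemma is_derive_drise (R : realType) (M L x : R) :
  is_derive x 1 (drise M L) (d2rise M L x).
Proof.
apply: (is_derive_eq (is_derive_affine_exp (L * expR (M * L))^-1 1 M M x)).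
by rewrite /d2rise; ring.
Qed.

Lemma is_derive_refl (R : realType) (g : R -> R) (s x d : R) :
  is_derive (s - x) 1 g d -> is_derive x 1 (fun y => g (s - y)) (- d).
Proof.
move=> gd; have h : is_derive x 1 (fun y => s - y) (-1 : R).
  have := is_derive_affine x s (-1); congr (is_derive x 1 _ (-1 : R)).
  by apply/funext => y; rewrite mulN1r.
have := @is_derive1_comp _ g (fun y => s - y) x d (-1) gd h.
by rewrite mulrN1.
Qed.

Lemma rise0 (R : realType) (M L : R) : rise M L 0 = 0.
Proof. by rewrite /rise mul0r mulr0. Qed.

Lemma riseL (R : realType) (M L : R) : 0 < L -> rise M L L = 1.
Proof.
by move=> L0; rewrite /rise mulVf // mulf_neq0 ?gt_eqF // expR_gt0.
Qed.

Lemma rise_gt0 (R : realType) (M L x : R) : 0 < L -> 0 < x -> 0 < rise M L x.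
Proof.
by move=> L0 x0; rewrite mulr_gt0 ?invr_gt0 // mulr_gt0 // expR_gt0.
Qed.

Lemma rise_ge0 (R : realType) (M L x : R) : 0 < L -> 0 <= x -> 0 <= rise M L x.
Proof.
move=> L0; rewrite le_eqVlt => /predU1P[<-|x0]; first by rewrite rise0.
exact/ltW/rise_gt0.
Qed.

Lemma drise_gt0 (R : realType) (M L x : R) :
  0 <= M -> 0 < L -> 0 <= x -> 0 < drise M L x.
Proof.
move=> M0 L0 x0; rewrite mulr_gt0 ?invr_gt0 ?mulr_gt0 ?expR_gt0 //.
by rewrite ltr_wpDr // mulr_ge0.
Qed.

Lemma d2rise_ge (R : realType) (M L x : R) :
  0 <= M -> 0 < L -> M * M * rise M L x <= d2rise M L x.
Proof.
move=> M0 L0; rewrite /rise /d2rise mulrCA; apply: ler_wpM2l.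
  by rewrite invr_ge0 mulr_ge0 ?expR_ge0 // ltW.
by rewrite mulrA; apply: ler_wpM2r; [exact: expR_ge0|rewrite lerDr; lra].
Qed.

(** Takes the values [alpha] at 0 and [beta] at [L]. *)
Definition arch (R : realType) (M L alpha beta x : R) : R :=
  alpha * rise M L (L - x) + beta * rise M L x.

Definition darch (R : realType) (M L alpha beta x : R) : R :=
  - alpha * drise M L (L - x) + beta * drise M L x.

Definition d2arch (R : realType) (M L alpha beta x : R) : R :=
  alpha * d2rise M L (L - x) + beta * d2rise M L x.

Lemma is_derive_arch (R : realType) (M L alpha beta x : R) :
  is_derive x 1 (arch M L alpha beta) (darch M L alpha beta x).
Proof.
have h1 := is_derive_refl (is_derive_rise M L (L - x)).
have := is_derive_lin beta (is_derive_lin alpha (is_derive_cst (0 : R) x (1 : R)) h1)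
  (is_derive_rise M L x).
have -> : (fun y : R => 0 + alpha * rise M L (L - y) + beta * rise M L y) =
   arch M L alpha beta by apply/funext => y; rewrite add0r.
by move=> h; apply: (is_derive_eq h); rewrite /darch; ring.
Qed.

Lemma is_derive_darch (R : realType) (M L alpha beta x : R) :
  is_derive x 1 (darch M L alpha beta) (d2arch M L alpha beta x).
Proof.
have h1 := is_derive_refl (is_derive_drise M L (L - x)).
have := is_derive_lin beta (is_derive_lin (- alpha) (is_derive_cst (0 : R) x (1 : R)) h1)
  (is_derive_drise M L x).
have -> : (fun y : R => 0 + - alpha * drise M L (L - y) + beta * drise M L y) =
   darch M L alpha beta by apply/funext => y; rewrite add0r.
by move=> h; apply: (is_derive_eq h); rewrite /d2arch; ring.
Qed.

Lemma arch0 (R : realType) (M L alpha beta : R) : 0 < L ->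
  arch M L alpha beta 0 = alpha.
Proof. by move=> L0; rewrite /arch subr0 riseL // rise0 mulr1 mulr0 addr0. Qed.

Lemma archL (R : realType) (M L alpha beta : R) : 0 < L ->
  arch M L alpha beta L = beta.
Proof. by move=> L0; rewrite /arch subrr riseL // rise0 mulr1 mulr0 add0r. Qed.

Lemma arch_gt0 (R : realType) (M L alpha beta x : R) : 0 < L ->
  0 < alpha -> 0 < beta -> 0 <= x <= L -> 0 < arch M L alpha beta x.
Proof.
move=> L0 a0 b0 /andP[]; rewrite le_eqVlt => /predU1P[<-|x0] xL.
  by rewrite arch0.
apply: ltr_wpDl; first by rewrite mulr_ge0 ?rise_ge0 ?subr_ge0 // ltW.
by rewrite mulr_gt0 ?rise_gt0.
Qed.

Lemma d2arch_ge (R : realType) (M L alpha beta x : R) : 0 <= M -> 0 < L ->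
  0 <= alpha -> 0 <= beta ->
  M * M * arch M L alpha beta x <= d2arch M L alpha beta x.
Proof.
move=> M0 L0 a0 b0; rewrite /arch /d2arch mulrDr lerD //.
  by rewrite mulrCA; apply: ler_wpM2l => //; exact: d2rise_ge.
by rewrite mulrCA; apply: ler_wpM2l => //; exact: d2rise_ge.
Qed.

(** Hopf's lemma: [psi] lies above [psi 0 * rise M r (r - x)], which has the same
    values at both ends, since a negative minimum of the difference would
    contradict [second_derivative_min].  The barrier has a negative slope at
    [r]. *)
Lemma hopf_slope (R : realType) (M r d : R) (psi dpsi : R -> R) :
  0 < M -> 0 < r -> {within `[0, r], continuous psi} ->
  0 < psi 0 -> psi r = 0 ->
  (forall x, 0 < x < r -> is_derive x 1 psi (dpsi x)) ->
  (forall x, 0 < x < r ->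
     exists2 d2, is_derive x 1 dpsi d2 & d2 <= M * M * psi x) ->
  lslope psi r d -> d < 0.
Proof.
move=> M0 r0 psic psi0 psir psid psidd psil.
pose b x := rise M r (r - x).
pose g x := psi x + - psi 0 * b x.
have bd (x : R) : is_derive x 1 b (- drise M r (r - x)).
  exact: is_derive_refl (is_derive_rise _ _ _).
have bdd (x : R) : is_derive x 1 (fun y => - drise M r (r - y)) (d2rise M r (r - x)).
  have := is_derive_lin (-1) (is_derive_cst (0 : R) x (1 : R))
    (is_derive_refl (is_derive_drise M r (r - x))).
  have -> : (fun y : R => 0 + -1 * drise M r (r - y)) =
     (fun y => - drise M r (r - y)) by apply/funext => y; rewrite add0r mulN1r.
  by move=> h; apply: (is_derive_eq h); ring.
have bc : {within `[0, r], continuous b}.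
  by apply: derivable_within_continuous => x _; have [] := bd x.
have gc : {within `[0, r], continuous g}.
  move=> x; apply: cvgD; first exact: psic.
  by apply: cvgM; [exact: cvg_cst|exact: bc].
have g0 : g 0 = 0 by rewrite /g /b subr0 riseL // mulr1 subrr.
have gr : g r = 0 by rewrite /g /b subrr rise0 mulr0 addr0.
have g_ge0 x : 0 <= x <= r -> 0 <= g x.
  have [c] := EVT_min (ltW r0) gc.
  rewrite in_itv /= => /andP[c0 cr] cmin xr.
  apply: le_trans (cmin x _); last by rewrite in_itv.
  case: (eqVneq c 0) => [->|cn0]; first by rewrite g0.
  case: (eqVneq c r) => [->|cnr]; first by rewrite gr.
  have {}c0 : 0 < c by rewrite lt_neqAle eq_sym cn0.
  have {}cr : c < r by rewrite lt_neqAle cnr.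
  have c0r : 0 < c < r by rewrite c0.
  have [d2 d2d d2le] := psidd c c0r.
  have nc := near_itvoo c0r.
  have : 0 <= d2 + - psi 0 * d2rise M r (r - c).
    apply: (@second_derivative_min _ g
      (fun y => dpsi y + - psi 0 * (- drise M r (r - y))) c).
    - by apply: filterS nc => y yr; apply: is_derive_lin => //; exact: psid.
    - by apply: filterS nc => y /andP[? ?]; apply: cmin; rewrite in_itv /= !ltW.
  move=> H; rewrite leNgt; apply/negP => gneg.
  have h1 : psi 0 * (M * M * rise M r (r - c)) <= psi 0 * d2rise M r (r - c).
    by rewrite ler_pM2l //; exact: d2rise_ge (ltW M0) r0.
  have h2 : M * M * (psi c - psi 0 * rise M r (r - c)) < 0.
    rewrite pmulr_rlt0 ?mulr_gt0 //.
    by move: gneg; rewrite /g /b mulNr.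
  by move: H h1 h2 d2le; clear; lra.
have gl : lslope g r (d + - psi 0 * (- drise M r 0)).
  apply: lslope_lin => //; have := is_derive_lslope (bd r).
  by rewrite subrr.
have : d + - psi 0 * (- drise M r 0) <= 0.
  apply: (lslope_le0 r0 _ gl) => y /andP[y0 yr].
  by rewrite gr; apply: g_ge0; rewrite !ltW.
have : 0 < psi 0 * drise M r 0 by rewrite mulr_gt0 // drise_gt0 // ltW.
by clear; lra.
Qed.

(** * Barriers on a graph *)

(** Take for [d x] the length of a shortest walk from [x] to [root]. *)
Lemma exists_distance (T : finType) (e : rel T) (root : T) :
  (forall x, connect e x root) ->
  exists d : T -> nat, forall x, x != root -> exists2 y, e x y & (d y < d x)%N.
Proof.
move=> cr.
pose walk x n := [exists p : n.-tuple T, path e x p && (last x p == root)].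
have ex x : exists n, walk x n.
  have /connectP[p ep rE] := cr x; exists (size p).
  by apply/existsP; exists (in_tuple p); rewrite ep -rE eqxx.
exists (fun x => ex_minn (ex x)) => x xr.
case: (ex_minnP (ex x)) => n /existsP[[[|y p] /= sz]].
  by rewrite (negPf xr).
move=> /andP[/andP[exy py] lp] _; exists y => //.
case: (ex_minnP (ex y)) => m _ /(_ (size p)) mmin.
rewrite -(eqP sz) ltnS; apply: mmin.
by apply/existsP; exists (in_tuple p); rewrite py.
Qed.

Definition edge_arch (R : realType) (G : metric_graph R) (M : R)
    (kv : vertex G -> R) : graph_fun G :=
  fun e x => if term G e is Some (L, w) then arch M L (kv (orig G e)) (kv w) x
             else 0.

Definition edge_darch (R : realType) (G : metric_graph R) (M : R)
    (kv : vertex G -> R) : graph_fun G :=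
  fun e x => if term G e is Some (L, w) then darch M L (kv (orig G e)) (kv w) x
             else 0.

Lemma edge_arch_single_valued (R : realType) (G : metric_graph R) (M : R)
    (kv : vertex G -> R) : bounded_graph G ->
  (forall e L w, term G e = Some (L, w) -> 0 < L) ->
  single_valued (edge_arch M kv).
Proof.
move=> bG L0; exists kv => e x v; rewrite /edge_arch.
case H : (term G e) (bG e) => [[L w]|] // _ [[-> <-]|].
  by rewrite arch0 //; exact: L0 H.
by rewrite H => -[<- <-]; rewrite archL //; exact: L0 H.
Qed.

(** Prescribe the value [b ^+ d v] at the vertex [v].  A vertex off the boundary
    has a neighbour whose value is larger by a factor [b^-1] or more; for small [b]
    the slope towards that neighbour outweighs all other slopes, whose negative
    part is at most a multiple of the value at the vertex itself. *)
Lemma exists_outflowing_arch (R : realType) (G : metric_graph R) (M : R)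
    (bd : {set vertex G}) (d : vertex G -> nat) : 0 <= M ->
  (forall e L w, term G e = Some (L, w) -> 0 < L) ->
  (forall e, 0 < thickness G e) ->
  (forall v, v \notin bd -> exists2 w, joined v w & (d w < d v)%N) ->
  exists kv : vertex G -> R, (forall v, 0 < kv v) /\
    forall v, v \notin bd -> 0 < flux (edge_darch M kv) v.
Proof.
move=> M0 L0 th0 dP.
pose lo (e : edge G) := if term G e is Some (L, _) then
  thickness G e * drise M L 0 else 1.
pose hi (e : edge G) := if term G e is Some (L, _) then
  2 * (thickness G e * drise M L L) else 0.
have lo0 e : 0 < lo e.
  rewrite /lo; case H : (term G e) => [[L w]|] //.
  by rewrite mulr_gt0 // drise_gt0 // (L0 _ _ _ H).
have hi0 e : 0 <= hi e.
  rewrite /hi; case H : (term G e) => [[L w]|] //.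
  have ? := L0 _ _ _ H.
  apply: mulr_ge0 => //; apply: mulr_ge0; first exact: ltW.
  by apply/ltW/drise_gt0 => //; exact: ltW.
pose S := \sum_e hi e; pose I := \sum_e (lo e)^-1.
have S0 : 0 <= S by apply: sumr_ge0.
have I0 : 0 <= I by apply: sumr_ge0 => e _; rewrite invr_ge0 ltW.
have SI0 : 0 < 1 + S * I by rewrite ltr_pwDl // mulr_ge0.
pose b := (1 + S * I)^-1.
have b0 : 0 < b by rewrite invr_gt0.
have b1 : b <= 1 by rewrite invf_le1 // lerDl mulr_ge0.
pose kv v := b ^+ d v.
have kv0 v : 0 < kv v by apply: exprn_gt0.
have kv_lt v w : (d w < d v)%N -> kv v <= b * kv w.
  move=> dwv; rewrite /kv -exprS; apply: ler_wiXn2l => //; exact: ltW.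
have bS e : b * S < lo e.
  rewrite mulrC ltr_pdivrMr // mulrDr mulr1.
  have : S <= lo e * (S * I).
    rewrite mulrCA -[leLHS]mulr1; apply: ler_wpM2l => //.
    rewrite /I (bigD1 e) //= mulrDr divff ?gt_eqF // lerDl.
    apply: mulr_ge0; first exact: ltW.
    by apply: sumr_ge0 => ? _; rewrite invr_ge0 ltW.
  by move: (lo0 e); clear; lra.
exists kv; split => // v vbd.
have [w vw dwv] := dP v vbd.
have wv : w != v by apply/eqP => E; move: dwv; rewrite E ltnn.
have [e0 e0P] : exists e0, (orig G e0 == v) && (omap snd (term G e0) == Some w)
    || (orig G e0 == w) && (omap snd (term G e0) == Some v).
  by move: vw => /existsP.
pose t e := thickness G e *
    ((if orig G e == v then edge_darch M kv e 0 else 0)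
     + (if term G e is Some (L, w) then
          if w == v then - edge_darch M kv e L else 0
        else 0)).
have tE e L w' (H : term G e = Some (L, w')) : t e = thickness G e *
    ((if orig G e == v then - kv v * drise M L L + kv w' * drise M L 0 else 0)
     + (if w' == v then kv (orig G e) * drise M L 0 - kv v * drise M L L else 0)).
  rewrite /t /edge_darch H /darch subr0 subrr; congr (_ * (_ + _)).
    by case: eqP => // ->.
  by case: eqP => // ->; ring.
have hiE e L w' (H : term G e = Some (L, w')) :
  hi e = 2 * (thickness G e * drise M L L) by rewrite /hi H.
have loE e L w' (H : term G e = Some (L, w')) :
  lo e = thickness G e * drise M L 0 by rewrite /lo H.
have t_ge e : - (hi e * kv v) <= t e.
  case H : (term G e) => [[L w']|]; last first.
    rewrite /t /hi /edge_darch H mul0r oppr0 addr0.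
    by case: ifP; rewrite mulr0.
  have L0' := L0 _ _ _ H.
  rewrite (tE _ _ _ H) (hiE _ _ _ H).
  set A := drise M L L; set B := drise M L 0.
  have A0 : 0 < A by rewrite drise_gt0 // ltW.
  have B0 : 0 < B by rewrite drise_gt0.
  have -> : - (2 * (thickness G e * A) * kv v) = thickness G e * (- (2 * (kv v * A))).
    by ring.
  apply: ler_wpM2l; first exact: ltW.
  have h1 : 0 < kv v * A by rewrite mulr_gt0.
  have h2 : 0 < kv w' * B by rewrite mulr_gt0.
  have h3 : 0 < kv (orig G e) * B by rewrite mulr_gt0.
  by move: h1 h2 h3; case: ifP => _; case: ifP => _; clear; lra.
have t0_ge : lo e0 * kv w - hi e0 * kv v <= t e0.
  case H : (term G e0) e0P => [[L w']|] /=; last by rewrite !andbF.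
  have L0' := L0 _ _ _ H.
  rewrite (tE _ _ _ H) (hiE _ _ _ H) (loE _ _ _ H).
  set A := drise M L L; set B := drise M L 0.
  have A0 : 0 < A by rewrite drise_gt0 // ltW.
  have h1 : 0 < thickness G e0 * (kv v * A).
    by apply: mulr_gt0 => //; exact: mulr_gt0.
  move=> /orP[] /andP[/eqP oE /eqP wE]; case: wE => wE; rewrite oE wE;
    rewrite eqxx (negPf wv); move: h1; clear; lra.
rewrite /flux -/(t _) (bigD1 e0) //=.
have : - ((S - hi e0) * kv v) <= \sum_(e | e != e0) t e.
  have -> : S - hi e0 = \sum_(e | e != e0) hi e.
    by rewrite /S (bigD1 e0) //= addrAC subrr add0r.
  rewrite mulr_suml -sumrN; apply: ler_sum => e _; exact: t_ge.
have h1 : S * kv v <= S * (b * kv w) by apply: ler_wpM2l => //; exact: kv_lt.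
have h2 : b * S * kv w < lo e0 * kv w by rewrite ltr_pM2r.
have e1 : S * (b * kv w) = b * S * kv w by ring.
by move: t0_ge h1 h2; rewrite e1 -/(t e0); clear; lra.
Qed.

(** * Truncation *)

Lemma flux_truncated (R : realType) (D : metric_graph R) (N : nat)
    (P : 'I_N -> vertex D) (rho : 'I_N -> R) (r : R)
    (dg : graph_fun (truncated P rho r)) (v : vertex D) :
  flux dg (inl v : vertex (truncated P rho r)) =
  @flux R (with_outer_paths P rho) dg v.
Proof.
apply: eq_bigr => -[e|j] _ /=; congr (_ * (_ + _)).
by case: (term D e) => [[L w]|].
Qed.

Lemma truncated_distance (R : realType) (D : metric_graph R) (N : nat)
    (P : 'I_N -> vertex D) (rho : 'I_N -> R) (r : R) (i : 'I_N) :
  is_metric_graph D ->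
  exists d : vertex (truncated P rho r) -> nat,
  forall v, v \notin truncation_boundary P rho r ->
    exists2 w, joined v w & (d w < d v)%N.
Proof.
move=> [_ _ conn].
have [d dP] := exists_distance (fun x => conn x (P i)).
exists (fun v => match v with inl v => (d v).+1 | inr _ => 0%N end).
move=> [v|j] /=; last by rewrite /truncation_boundary imset_f.
move=> _; case: (eqVneq v (P i)) => [->|vP].
  by exists (inr i) => //; apply/existsP; exists (inr i); rewrite /= !eqxx.
have [w vw dw] := dP v vP; exists (inl w) => //.
move: vw => /existsP[e H]; apply/existsP; exists (inl e) => /=.
move: H; case: (term D e) => [[L w']|] /=; last by rewrite !andbF.
by [].
Qed.

Lemma smooth_subsolution_eq (R : realType) (q delta a b x : R) (g h : R -> R) :
  a < x < b -> (forall y, a < y < b -> g y = h y) ->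
  smooth_subsolution q delta g x -> smooth_subsolution q delta h x.
Proof.
move=> axb gh [dg [d [gd dgd ineq]]]; exists dg, d; split => //.
  apply: filterS2 gd (near_itvoo axb) => y gy ayb.
  apply: near_eq_is_derive gy; apply: filterS (near_itvoo ayb) => z.
  exact: gh.
by rewrite -(gh x axb).
Qed.

Lemma exists_small_multiple (R : realType) (I : finType) (C k : I -> R) :
  (forall j, 0 < k j) -> exists2 eta, 0 < eta & forall j, eta * C j < k j.
Proof.
move=> k0.
have : \forall eta \near (0 : R)^'+, forall j, eta * C j < k j.
  apply: filter_forall => j.
  have C0 : 0 < `|C j| + 1 by rewrite ltr_wpDl.
  near=> eta.
  have eta0 : 0 < eta by near: eta; exact: nbhs_right_gt.
  apply: le_lt_trans (_ : eta * (`|C j| + 1) < _).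
    by rewrite ler_pM2l // (le_trans (ler_norm _)) // lerDl.
  rewrite -ltr_pdivlMr //; near: eta; apply: nbhs_right_lt; exact: divr_gt0.
move=> H; have : \forall eta \near (0 : R)^'+, 0 < eta /\ forall j, eta * C j < k j.
  near=> eta; split; first by near: eta; exact: nbhs_right_gt.
  by near: eta; exact: H.
by move=> /filter_ex[eta [? ?]]; exists eta.
Unshelve. all: by end_near. Qed.

(** If [lambda <= 0], then [psi + eta * K], with [K] the barrier on the truncated
    graph, satisfies the differential inequality of a strict subsolution there.
    On the path number [j] it takes the value [eta * kv (inr j) > 0] at [r], and
    it is continued by a decreasing barrier that vanishes at [r + 1].  The slope
    of the continuation at [r] is of order [eta], whereas [psi] arrives at [r]
    with a negative slope by [hopf_slope]; so the kink at [r] is convex for small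
    [eta], and [no_strict_subsolution] gives a contradiction. *)
Lemma no_nonpositive_eigenvalue (R : realType)
    (f : R -> R) (D : metric_graph R) (N : nat) (P : 'I_N -> vertex D)
    (rho : 'I_N -> R) (i : 'I_N) (u : R -> graph_fun (with_outer_paths P rho))
    (r lambda : R) (psi : graph_fun (truncated P rho r)) :
  (forall s, derivable f s 1) -> continuous f^`()%classic ->
  is_metric_graph D -> bounded_graph D -> (forall j, 0 < rho j) ->
  entire_solution f u ->
  (forall t (e : edge (with_outer_paths P rho)) x, edge_dom e x -> 0 < u t e x < 1) ->
  increasing_in_time u -> 0 < r ->
  eigen_equation (truncation_boundary P rho r)
    (fun e x => f^`()%classic (limit_profile u e x)) lambda psi ->
  (forall (e : edge (truncated P rho r)) x, edge_dom e x ->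
     (forall v, v \in truncation_boundary P rho r -> ~ at_vertex e x v) ->
     0 < psi e x) ->
  0 < lambda.
Proof.
move=> fd f'c Dgraph Dbd rho0 usol u01 um r0 [psic psis [dpsi [psiD psiDD psik]] psibd]
  psipos.
rewrite ltNge; apply/negP => lambda0.
pose Gt := truncated P rho r; pose G := with_outer_paths P rho.
have [DL0 Dth0 _] := Dgraph.
pose q (e : edge G) x := f^`()%classic (limit_profile u e x).
have [Q Q0 f'Q] := segment_bounded ler01 (continuous_subspaceT f'c).
have qQ (e : edge G) x : edge_dom e x -> `|q e x| <= Q.
  move=> xd; have [_ h1 h2] := limit_profile_cvg (fun t => u01 t e x xd) um xd.
  apply: f'Q; rewrite h2 andbT; apply/ltW; apply: lt_trans (h1 0).
  by have /andP[] := u01 0 e x xd.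
pose M := Q + 1.
have M0 : 0 < M by rewrite addr_gt0.
have MM : Q + 1 <= M * M by rewrite /M ler_peMl //; lra.
pose lenT (e : edge Gt) : R := match e with
  | inl e => if term D e is Some (L, _) then L else 1
  | inr _ => r end.
have termT e : exists w, term Gt e = Some (lenT e, w).
  case: e => [e|j] /=; last by exists (inr j).
  by case H : (term D e) (Dbd e) => [[L w]|] // _; exists (inl w).
have lenT0 e : 0 < lenT e.
  case: e => [e|j] //=; case H : (term D e) => [[L w]|] //; exact: DL0 H.
have lenTP : compact_lengths lenT.
  by split => // e L w; have [w' ->] := termT e => -[].
have GtL0 e L w : term Gt e = Some (L, w) -> 0 < L.
  by have [w' ->] := termT e => -[<- _].
have Gtbd : bounded_graph Gt by move=> e; have [w ->] := termT e.
have Gtth0 e : 0 < thickness Gt e by case: e => [e|j] /=.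
have domT (e : edge Gt) x : 0 <= x <= lenT e -> edge_dom e x by exact: edge_dom_len.
have subT (e : edge Gt) : `[0, lenT e] `<=` edge_dom e.
  by move=> x /=; rewrite in_itv /=; exact: domT.
have psicT (e : edge Gt) : {within `[0, lenT e], continuous (psi e)}.
  exact: continuous_subspaceW (psic e).
have psi_pos (e : edge Gt) x : edge_dom e x -> (forall j, e = inr j -> x != r) ->
    0 < psi e x.
  move=> xd xr; apply: psipos => // w /imsetP[j _ ->].
  case=> [[_]|]; first by case: e xd xr.
  case: e xd xr => [e|j'] xd xr /=.
    by case: (term D e) => [[L w']|] //= -[].
  by move=> -[xE jE]; have := xr j'; rewrite xE eqxx => /(_ erefl).
have psi_r j : psi (inr j) r = 0.
  by apply: (psibd _ _ (inr j)); [exact: imset_f|right].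
have psi_ge0 (e : edge Gt) x : 0 <= x <= lenT e -> 0 <= psi e x.
  case: e => [e|j] xl.
    by apply/ltW/psi_pos; first exact: domT.
  case: (eqVneq x r) => [->|xr]; first by rewrite psi_r.
  by apply/ltW/psi_pos; first exact: domT.
have psid (e : edge Gt) x : 0 < x < lenT e -> is_derive x 1 (psi e) (dpsi e x).
  move=> xl; have xi := edge_interior_len lenTP xl.
  apply: (@is_derive_of_within _ (edge_dom e)).
    by apply: filterS (nbhs_edge_interior xi) => y; exact: edge_interior_dom.
  by apply: psiD; exact: edge_interior_dom.
have psidd (e : edge Gt) x : 0 < x < lenT e ->
    exists2 d2, is_derive x 1 (dpsi e) d2 & - d2 - q e x * psi e x = lambda * psi e x.
  by move=> xl; apply: psiDD; exact: edge_interior_len xl.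
have dom_lenT (e : edge G) x : 0 <= x <= lenT e -> edge_dom e x.
  case: e => [e|j] /andP[x0 xl]; split => //=.
  by move: xl => /=; case: (term D e) => [[L w]|].
have psir_lt0 j : dpsi (inr j) r < 0.
  have psi_l : lslope (psi (inr j)) r (dpsi (inr j) r).
    apply: (@is_derive_within_lslope _ (edge_dom (inr j : edge Gt)) _ _ 0) => //.
      by move=> y /andP[? ?]; apply: domT; rewrite /= !ltW.
    by apply: psiD; apply: domT; rewrite /= lexx ltW.
  (* psi'' = - (q + lambda) * psi, and M' ^+ 2 >= M' >= Q - lambda *)
  pose M' := M - lambda.
  have M'0 : 0 < M' by rewrite subr_gt0 (le_lt_trans lambda0).
  apply: (hopf_slope M'0 r0 (psicT (inr j)) _ (psi_r j) (psid (inr j)) _ psi_l).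
    apply: psi_pos; first by apply: domT; rewrite lexx ltW.
    by move=> _ _; rewrite eq_sym gt_eqF.
  move=> x xr; have [d2 d2d d2E] := psidd (inr j) x xr.
  exists d2 => //.
  have x0r : 0 <= x <= r by case/andP: xr => *; rewrite !ltW.
  have px := psi_ge0 (inr j) x x0r.
  have -> : d2 = - (q (inr j) x + lambda) * psi (inr j) x.
    by move: d2E; clear; lra.
  apply: ler_wpM2r => //.
  have := qQ (inr j) x (dom_lenT (inr j) x x0r); rewrite ler_norml => /andP[qlo _].
  have h : M' <= M' * M' by rewrite ler_peMl ?(ltW M'0) // /M' /M; move: Q0 lambda0; clear; lra.
  apply: le_trans h; rewrite /M' /M; move: qlo; clear; lra.
have [d dP] := truncated_distance P rho r i Dgraph.
have [kv [kv0 kvflux]] := exists_outflowing_arch (ltW M0) GtL0 Gtth0 dP.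
pose K : graph_fun Gt := edge_arch M kv.
pose dK : graph_fun Gt := edge_darch M kv.
pose w (e : edge Gt) : vertex Gt := if term Gt e is Some (_, w) then w else inr i.
have KE e x : K e x = arch M (lenT e) (kv (orig Gt e)) (kv (w e)) x.
  by rewrite /K /edge_arch /w; have [w' ->] := termT e.
have dKE e x : dK e x = darch M (lenT e) (kv (orig Gt e)) (kv (w e)) x.
  by rewrite /dK /edge_darch /w; have [w' ->] := termT e.
have Kd e (x : R) : is_derive x 1 (K e) (dK e x).
  have := is_derive_arch M (lenT e) (kv (orig Gt e)) (kv (w e)) x.
  rewrite -dKE; congr (is_derive x 1 _ _).
  by apply/funext => y; rewrite KE.
have dKd e (x : R) : is_derive x 1 (dK e)
    (d2arch M (lenT e) (kv (orig Gt e)) (kv (w e)) x).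
  have := is_derive_darch M (lenT e) (kv (orig Gt e)) (kv (w e)) x.
  by congr (is_derive x 1 _ _); apply/funext => y; rewrite dKE.
have Kc (e : edge Gt) (A : set R) : {within A, continuous (K e)}.
  apply: continuous_subspaceT => x.
  by apply: differentiable_continuous; apply/derivable1_diffP; have [] := Kd e x.
have Kpos (e : edge Gt) x : 0 <= x <= lenT e -> 0 < K e x.
  by move=> xl; rewrite KE arch_gt0.
have A0 e : (`[0, lenT e]%classic : set R) !=set0.
  by exists 0; rewrite /= in_itv /= lexx ltW.
have cA e : compact (`[0, lenT e]%classic : set R) by exact: segment_compact.
have [kappa kappa0 Kkappa] : exists2 kappa, 0 < kappa & forall e x,
    0 <= x <= lenT e -> kappa <= K e x.
  have [e1 [x1 [x1l x1min]]] := compact_min_fin (inr i : edge Gt) A0 cA (fun e => Kc e _).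
  exists (K e1 x1); first by apply: Kpos; move: x1l; rewrite /= in_itv.
  by move=> e x xl; apply: x1min; rewrite /= in_itv.
have [Psi Psi0 psiPsi] : exists2 Psi, 0 <= Psi & forall e x,
    0 <= x <= lenT e -> psi e x <= Psi.
  have gc (e : edge Gt) : {within `[0, lenT e], continuous (fun x => - psi e x)}.
    by move=> x; apply: cvgN; exact: psicT.
  have [e1 [x1 [x1l x1min]]] := compact_min_fin (inr i : edge Gt) A0 cA gc.
  exists (psi e1 x1); first by apply: psi_ge0; move: x1l; rewrite /= in_itv.
  by move=> e x xl; rewrite -lerN2; apply: x1min; rewrite /= in_itv.
have drise11 : 0 < drise M 1 1 by rewrite drise_gt0 // ltW.
(* this bound on eta is the convexity of the kink at each truncation point *)
have [eta eta0 etaP] : exists2 eta, 0 < eta & forall j : 'I_N,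
    eta * (dK (inr j) r + kv (inr j) * drise M 1 1) < - dpsi (inr j) r.
  by apply: exists_small_multiple => j; rewrite oppr_gt0.
(* the largest delta with delta * (Psi + eta * kappa) <= eta * kappa *)
pose delta := eta * kappa / (Psi + eta * kappa).
have ek0 : 0 < eta * kappa by rewrite mulr_gt0.
have Pek0 : 0 < Psi + eta * kappa by rewrite ltr_wpDl.
have delta0 : 0 < delta by rewrite divr_gt0.
have delta1 : delta <= 1 by rewrite ler_pdivrMr // mul1r lerDr.
have delta_le (e : edge Gt) x : 0 <= x <= lenT e ->
    delta * (psi e x + eta * K e x) <= eta * K e x.
  move=> xl.
  have h1 : delta * psi e x <= delta * Psi by rewrite ler_pM2l // psiPsi.
  have h2 : (1 - delta) * (eta * kappa) <= (1 - delta) * (eta * K e x).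
    by apply: ler_wpM2l; [rewrite subr_ge0|rewrite ler_pM2l // Kkappa].
  have h3 : delta * (Psi + eta * kappa) = eta * kappa by rewrite divfK // gt_eqF.
  by move: h1 h2 h3; clear; lra.
have subsol (e : edge Gt) x : 0 < x < lenT e ->
    smooth_subsolution (q e x) delta (fun y => psi e y + eta * K e y) x.
  move=> xl; have [d2 d2d d2E] := psidd e x xl.
  have xl' : 0 <= x <= lenT e by case/andP: xl => *; rewrite !ltW.
  exists (fun y => dpsi e y + eta * dK e y),
    (d2 + eta * d2arch M (lenT e) (kv (orig Gt e)) (kv (w e)) x); split.
  - apply: filterS (near_itvoo xl) => y yl.
    exact: is_derive_lin (psid e y yl) (Kd e y).
  - exact: is_derive_lin d2d (dKd e x).
  - apply: le_trans (delta_le e x xl') _.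
    set k2 := d2arch _ _ _ _ _.
    have k2M : M * M * K e x <= k2 by rewrite KE d2arch_ge // ltW.
    have := qQ e x (dom_lenT e x xl'); rewrite ler_norml => /andP[qlo _].
    have h1 : (Q + 1) * K e x <= M * M * K e x by rewrite ler_pM2r // Kpos.
    have h2 : - Q * K e x <= q e x * K e x by rewrite ler_pM2r // Kpos.
    have h3 : eta * K e x <= eta * (k2 + q e x * K e x).
      by rewrite ler_pM2l //; move: h1 h2 k2M; clear; lra.
    have h4 : lambda * psi e x <= 0 by apply: mulr_le0_ge0 => //; exact: psi_ge0.
    by move: h3 h4 d2E; clear; lra.
pose tail (j : 'I_N) x := eta * kv (inr j) * rise M 1 (r + 1 - x).
pose zeta (e : edge G) x := match e with
  | inl e => psi (inl e) x + eta * K (inl e) x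
  | inr j => if x <= r then psi (inr j) x + eta * K (inr j) x else tail j x
  end.
pose dzeta (e : edge G) x := dpsi e x + eta * dK e x.
pose len (e : edge G) : R := if e is inr _ then r + 1 else lenT e.
have lenP : compact_lengths len.
  split; first by case=> [e|j]; [exact: (lenT0 (inl e))|rewrite /= addr_gt0].
  by case=> [e|j] L v //= ->.
have r1 : r < r + 1 by rewrite ltrDl.
have K_r j : K (inr j) r = kv (inr j) by rewrite KE archL.
have tail_r j : tail j r = eta * kv (inr j).
  by rewrite /tail addrAC subrr add0r riseL // mulr1.
have taild j (x : R) : is_derive x 1 (tail j)
    (eta * kv (inr j) * - drise M 1 (r + 1 - x)).
  have := is_derive_lin (eta * kv (inr j)) (is_derive_cst (0 : R) x (1 : R))
    (is_derive_refl (is_derive_rise M 1 (r + 1 - x))).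
  rewrite add0r; congr (is_derive x 1 _ _).
  by apply/funext => y; rewrite add0r.
have taildd j (x : R) : is_derive x 1 (fun x => eta * kv (inr j) * - drise M 1 (r + 1 - x))
    (eta * kv (inr j) * d2rise M 1 (r + 1 - x)).
  have := is_derive_lin (- (eta * kv (inr j))) (is_derive_cst (0 : R) x (1 : R))
    (is_derive_refl (is_derive_drise M 1 (r + 1 - x))).
  have -> : (fun y : R => 0 + - (eta * kv (inr j)) * drise M 1 (r + 1 - y)) =
     (fun y => eta * kv (inr j) * - drise M 1 (r + 1 - y)).
    by apply/funext => y; ring.
  by move=> h; apply: (is_derive_eq h); ring.
have tailc j (A : set R) : {within A, continuous (tail j)}.
  apply: continuous_subspaceT => x.
  by apply: differentiable_continuous; apply/derivable1_diffP; have [] := taild j x.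
have zetaT_c (e : edge Gt) : {within `[0, lenT e], continuous (fun x => psi e x + eta * K e x)}.
  move=> x; apply: cvgD; first exact: psicT.
  by apply: cvgM; [exact: cvg_cst|exact: (Kc e)].
apply: (@no_strict_subsolution _ f G u len zeta dzeta delta) => //.
- case=> [e|j]; first exact: (zetaT_c (inl e)).
  have -> : `[0, len (inr j)]%classic = `[0, r] `|` `[r, r + 1] :> set R.
    apply/seteqP; split => x /=; rewrite !in_itv /=.
      move=> /andP[x0 xr]; have [xr'|rx] := leP x r; first by left; rewrite x0.
      by right; rewrite ltW.
    move=> [|] /andP[h1 h2]; apply/andP; split => //.
      exact: le_trans h2 (ltW r1).
    exact: le_trans (ltW r0) h1.
  apply: withinU_continuous; [exact: itv_closed|exact: itv_closed| |].
  + apply: subspace_eq_continuous (zetaT_c (inr j)) => x /set_mem /=.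
    by rewrite in_itv /= => /andP[_ xr]; rewrite /from_subspace /zeta xr.
  + apply: subspace_eq_continuous (tailc j _) => x /set_mem /=.
    rewrite in_itv /= => /andP[rx _]; rewrite /from_subspace /zeta.
    case: ifP => // xr; have -> : x = r by apply/eqP; rewrite eq_le xr.
    by rewrite tail_r psi_r K_r add0r.
- have [pv pvE] := psis; have [kv' kvE] := edge_arch_single_valued M kv Gtbd GtL0.
  exists (fun v => pv (inl v) + eta * kv' (inl v)) => e x v xv.
  have xv' : at_vertex (e : edge Gt) x (inl v).
    case: e xv => [e|j] [[-> <-]|/= H]; [by left|right; by rewrite /= H|by left|by []].
  have <- := pvE _ _ _ xv'; have <- := kvE _ _ _ xv'.
  case: e xv {xv'} => [e|j] xv //=.
  case: xv => [[-> _]|//]; by rewrite (ltW r0).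
- have zT_ge0 (e : edge Gt) x : 0 <= x <= lenT e -> 0 <= psi e x + eta * K e x.
    by move=> xl; rewrite addr_ge0 ?psi_ge0 // mulr_ge0 // ltW // Kpos.
  case=> [e|j] x xl; first exact: (zT_ge0 (inl e)).
  move: xl => /= /andP[x0 xr1]; case: ifP => xr.
    by apply: (zT_ge0 (inr j)); rewrite x0.
  by rewrite /tail mulr_ge0 ?rise_ge0 ?subr_ge0 // ltW // mulr_gt0.
- exists (inr i), 0; first by rewrite /= lexx addr_ge0 // ltW.
  rewrite /= (ltW r0); apply: ltr_wpDl.
    by apply: (psi_ge0 (inr i)); rewrite /= lexx ltW.
  by rewrite mulr_gt0 // Kpos //= lexx ltW.
- case=> [e|j] /= H; first by case: (Dbd e).
  by rewrite leNgt r1 /= /tail subrr rise0 mulr0.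
- case=> [e|j] x xl; first by right; exact: (subsol (inl e)).
  move: xl => /= /andP[x0 xr1].
  have [xr|rx|->] := ltgtP x r.
  + right; apply: (smooth_subsolution_eq (a := 0) (b := r)) (subsol (inr j) x _).
    * by rewrite x0.
    * by move=> y /andP[_ yr]; rewrite /= (ltW yr).
    * by rewrite x0.
  + right; apply: (@smooth_subsolution_eq _ _ _ r (r + 1) _ (tail j)).
    * by rewrite rx.
    * by move=> y /andP[ry _]; rewrite /= leNgt ry.
    have xr' : 0 <= r + 1 - x by rewrite subr_ge0 ltW.
    exists (fun x => eta * kv (inr j) * - drise M 1 (r + 1 - x)),
      (eta * kv (inr j) * d2rise M 1 (r + 1 - x)); split => //.
      by apply: (@nearW _ (nbhs x)) => y; exact: taild.
    have := qQ (inr j) x (conj (ltW x0) I).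
    rewrite -/(q (inr j) x) ler_norml => /andP[qlo _].
    have t0 : 0 <= tail j x by rewrite mulr_ge0 ?rise_ge0 // ltW // mulr_gt0.
    have h1 : M * M * tail j x <= eta * kv (inr j) * d2rise M 1 (r + 1 - x).
      rewrite /tail mulrCA ler_pM2l ?mulr_gt0 //; apply: d2rise_ge => //; exact: ltW.
    have h2 : (Q + 1) * tail j x <= M * M * tail j x by apply: ler_wpM2r.
    have h3 : - Q * tail j x <= q (inr j) x * tail j x by apply: ler_wpM2r.
    have h4 : delta * tail j x <= 1 * tail j x by apply: ler_wpM2r.
    by move: h1 h2 h3 h4; clear; lra.
  + left; exists (dpsi (inr j) r + eta * dK (inr j) r), (eta * kv (inr j) * - drise M 1 1).
    split.
    * apply: (@eq_lslope _ (fun y => psi (inr j) y + eta * K (inr j) y) _ _ 0) => //.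
        by move=> y /andP[_ yr]; rewrite /= yr.
      apply: lslope_lin; last exact: is_derive_lslope.
      apply: (@is_derive_within_lslope _ (edge_dom (inr j : edge Gt)) _ _ 0) => //.
        by move=> y /andP[? ?]; apply: domT; rewrite /= !ltW.
      by apply: psiD; apply: domT; rewrite /= lexx ltW.
    * apply: (@eq_rslope _ (tail j) _ _ (r + 1)) => //.
        move=> y /andP[ry _] /=; case: ifP => // yr.
        have -> : y = r by apply/eqP; rewrite eq_le yr.
        by rewrite tail_r psi_r K_r add0r.
      have := is_derive_rslope (taild j r).
      by rewrite addrAC subrr add0r.
    * by have := etaP j; clear; lra.
- have zr (e : edge Gt) : rslope (fun x => psi e x + eta * K e x) 0 (dzeta e 0).
    apply: rslope_lin; last exact: is_derive_rslope.
    apply: (@is_derive_within_rslope _ (edge_dom e) _ _ (lenT e)) => //.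
      by move=> y /andP[? ?]; apply: domT; rewrite !ltW.
    by apply: psiD; apply: domT; rewrite lexx ltW.
  case=> [e|j]; first exact: (zr (inl e)).
  apply: eq_rslope r0 _ (zr (inr j)) => y /andP[_ yr].
  by rewrite /= (ltW yr).
- case=> [e|j] L v //= H.
  have LE : L = lenT (inl e) by rewrite /= H.
  apply: lslope_lin; last exact: is_derive_lslope.
  apply: (@is_derive_within_lslope _ (edge_dom (inl e : edge Gt)) _ _ 0).
  + by rewrite LE.
  + by move=> y /andP[? yL]; apply: domT; rewrite -LE !ltW.
  + by apply: psiD; apply: domT; rewrite LE lexx ltW.
- move=> v.
  have vbd : (inl v : vertex Gt) \notin truncation_boundary P rho r.
    by apply/imsetP => -[].
  have -> : flux dzeta v = flux (fun e x => dpsi e x + eta * dK e x : R) (inl v : vertex Gt).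
    by rewrite flux_truncated.
  rewrite flux_lin.
  have -> : flux dpsi (inl v) = 0 by exact: psik.
  by rewrite add0r mulr_gt0 // kvflux.
Qed.

Theorem theorem2p3 (R : realType)
    (f : R -> R) (a : R) (f_bistable : bistable f a)
    (phi : R -> R) (c : R) (phi_wave : traveling_wave f a phi c)
    (D : metric_graph R) (D_graph : is_metric_graph D)
    (D_bounded : bounded_graph D)
    (N : nat) (N_ge2 : (2 <= N)%N)
    (P : 'I_N -> vertex D)
    (rho : 'I_N -> R) (rho_gt0 : forall j, 0 < rho j)
    (i : 'I_N)
    (u : R -> graph_fun (with_outer_paths P rho))
    (u_front : front_like_solution f phi c i u)
    (u_incr : increasing_in_time u)
    (r : R) (r_gt0 : 0 < r) (lambda : R)
    (lambda_principal :
       principal_eigenvalue (truncation_boundary P rho r)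
         (fun e x => f^`()%classic (limit_profile u e x)) lambda) :
  0 < lambda.
Proof.
have [[fd f'c] _ _ _ _] := f_bistable.
have [usol u01 _] := u_front.
have [_ _ [psi psi_eig psi_pos]] := lambda_principal.
exact: (no_nonpositive_eigenvalue i fd f'c D_graph D_bounded rho_gt0 usol u01
  u_incr r_gt0 psi_eig psi_pos).
Qed.
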